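(* Let $P\subset\mathbb{R}^2$ be a convex polygon. If there exists a discrete multi-set $\Lambda$ in $\mathbb{R}^2$ such that $P+\Lambda$ multi-tiles, then there exists a lattice $L\subset\mathbb{R}^2$ such that $P+L$ multi-tiles (of a possibly different multiplicity).
   Context: A lattice of $\mathbb{R}^2$ is a discrete subgroup of $\mathbb{R}^2$ isomorphic to $\mathbb{Z}^2$ (full rank). A discrete multi-set $\Lambda$ in $\mathbb{R}^2$ is a discrete set each of whose points has a finite multiplicity in $\{1,2,\dots\}$. $P+\Lambda$ multi-tiles (of multiplicity $k$), where $k$ is a positive integer, if $\sum_{\lambda\in\Lambda}\chi_P(x-\lambda)=k$ for almost every $x\in\mathbb{R}^2$ (sum counted with multiplicity), where $\chi_P$ is the indicator function of $P$; ''multi-tiles'' means this holds for some positive integer $k$. Polygons have non-empty interior. *)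

(* Defs.v *)
From HB Require Import structures.
From mathcomp Require Import all_boot all_order all_algebra.
From mathcomp Require Import all_classical all_reals all_analysis.

Set Implicit Arguments.
Unset Strict Implicit.
Unset Printing Implicit Defensive.

Import Order.TTheory GRing.Theory Num.Theory.
Import numFieldNormedType.Exports.

Local Open Scope classical_set_scope.
Local Open Scope ring_scope.

(* [R^o * R^o] is [R * R] with its structure of a module over R, which
   [convex_set] needs. *)
Definition convex_hull (R : realType) (V : set (R * R)) : set (R * R) :=
  smallest (@convex_set R (R^o * R^o)%type) V.

Definition convex_polygon (R : realType) (P : set (R * R)) : Prop :=
  (exists2 V : set (R * R), finite_set V & P = convex_hull V) /\
  interior P !=set0.

(* Discrete in the subspace topology: S need not be closed. *)
Definition discrete_set (R : realType) (S : set (R * R)) : Prop :=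
  S `<=` isolated S.

(* A multi-set is given by its multiplicity function; the points of
   multiplicity 0 are those that do not belong to it. *)
Definition multiset_support (T : Type) (m : T -> nat) : set T :=
  [set l | (0 < m l)%N].

Definition discrete_multiset (R : realType) (m : R * R -> nat) : Prop :=
  discrete_set (multiset_support m).

Definition multiset_of_set (T : Type) (S : set T) : T -> nat :=
  fun l => (l \in S).

Definition multi_tiles_of_multiplicity (R : realType) (k : nat)
    (P : set (R * R)) (m : R * R -> nat) : Prop :=
  {ae (@lebesgue_measure R \x @lebesgue_measure R)%E, forall x : R * R,
    (\esum_(l in multiset_support m) ((m l)%:R * \1_P (x - l) : R)%:E
     = (k%:R : R)%:E)%E}.

Definition multi_tiles (R : realType) (P : set (R * R)) (m : R * R -> nat) :
    Prop :=
  exists2 k : nat, (0 < k)%N & multi_tiles_of_multiplicity k P m.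

Definition lattice (R : realType) (L : set (R * R)) : Prop :=
  [/\ zmod_closed (mem L), discrete_set L &
      exists f : {additive int * int -> R * R}, set_bij [set: int * int] L f].

(* Main.v *)
Require Import Defs.
From HB Require Import structures.
From mathcomp Require Import all_boot all_order all_algebra.
From mathcomp Require Import finmap all_classical all_reals all_analysis.
From mathcomp Require Import measurable_realfun ring lra.

(** Let [w] be the multiplicity function of the tiling. Comparing the tiling on
    the two sides of an edge direction shows that, for a pair of opposite edges
    [a + [0,1) e] and [a + t + [0,1) e] (whose lengths agree by a density
    argument), the number of points of the multi-set on [x - [0,1) e] is
    [t]-periodic in [x]; hence the difference operators of [e] and [t] annihilate
    [w], and [w = E_e w + E_t w - E_t E_e w], where [E_v] averages over the
    translations by [n v] (along an ultrafilter). Applying this to all edges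
    gives a product [A] of averages with [A w <> 0] and, for each edge, a vector
    [v] in [{e, t}] such that all [A f] are [v]-periodic. As the multi-set has
    bounded density, the pigeonhole principle shows that the chosen [v] are
    commensurable; if [v = e], averaging the counts on [x - [0,1) e] shows that
    [t] is also commensurable with them modulo [R e]. So some lattice contains,
    for each edge, either [t], or both [e] and a point of [t + R e]. For such a
    lattice the translates of the polygon balance along every edge, so the
    number of translates covering a point is constant. *)

Set Implicit Arguments.
Unset Strict Implicit.
Unset Printing Implicit Defensive.
Import Order.TTheory GRing.Theory Num.Theory.
Import numFieldNormedType.Exports.
Local Open Scope classical_set_scope.
Local Open Scope ring_scope.

(** * Convex polygons as intersections of half-planes *)

Section Plane.
Variable R : realType.
Implicit Types (p q n u v x : R * R) (s : seq (R * R)) (hs : seq (R * R * R)).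

(** The tiling holds only almost everywhere, while the edge argument needs identities at every
    point. The bridge is [half hs v], where each side is kept or removed according to a direction
    [v] parallel to none of them: its count at [x] is the count of the closed polygon on an open set
    of points accumulating at [x], so it equals [k] at every [x]. Turning [v] across a side
    direction exchanges two opposite half-open edges and nothing else, which is how edges get
    compared. For the lattice the same device runs backwards: balanced edges make the count
    independent of [v], and then of [x]. The danger of averaging is that it may kill [w], which is
    why only one of [e] and [t] is guaranteed for each edge. If it is [e], then [t] need not be a
    period of the averages of [w], but it is one of the counts on segments along [e], whose average
    dominates that of [w]. The position along [e] is lost in this way; this is harmless, because a
    half-open edge may slide along itself when [e] is a period. *)

Definition dot n p : R := n.1 * p.1 + n.2 * p.2.
Definition smul (a : R) p : R * R := (a * p.1, a * p.2).
Definition rot p : R * R := (- p.2, p.1).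

Lemma dotDr n p q : dot n (p + q) = dot n p + dot n q.
Proof. by rewrite /dot /=; ring. Qed.

Lemma dotBr n p q : dot n (p - q) = dot n p - dot n q.
Proof. by rewrite /dot /=; ring. Qed.

Lemma dotZr n a p : dot n (smul a p) = a * dot n p.
Proof. by rewrite /dot /=; ring. Qed.

Lemma dotNr n p : dot n (- p) = - dot n p.
Proof. by rewrite /dot /=; ring. Qed.

Lemma dotNl n p : dot (- n) p = - dot n p.
Proof. by rewrite /dot /=; ring. Qed.

Lemma dotZl n a p : dot (smul a n) p = a * dot n p.
Proof. by rewrite /dot /=; ring. Qed.

Lemma pairP p q : p.1 = q.1 -> p.2 = q.2 -> p = q.
Proof. by case: p q => [? ?] [? ?] /= -> ->. Qed.

Lemma dot_rot n : dot n (rot n) = 0.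
Proof. by rewrite /dot /=; ring. Qed.

Lemma dotnn_gt0 n : n != 0 -> 0 < dot n n.
Proof.
move=> n0; rewrite lt_neqAle eq_sym /dot addr_ge0 ?andbT -?expr2 ?sqr_ge0//.
rewrite paddr_eq0 ?sqr_ge0// !sqrf_eq0; apply: contra n0 => /andP[/eqP a /eqP b].
by apply/eqP/pairP.
Qed.

Lemma rot_neq0 n : n != 0 -> rot n != 0.
Proof.
apply: contra => /eqP [a b]; apply/eqP/pairP => //.
by apply/eqP; rewrite -oppr_eq0 a.
Qed.

Lemma dot0_rot n u : n != 0 -> dot n u = 0 ->
  u = smul (dot (rot n) u / dot n n) (rot n).
Proof.
move=> /dotnn_gt0 n0 nu; have {n0}: dot n n != 0 by rewrite gt_eqF.
have : u.1 * dot n n - dot (rot n) u * - n.2 = n.1 * dot n u by rewrite /dot/=; ring.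
have : u.2 * dot n n - dot (rot n) u * n.1 = n.2 * dot n u by rewrite /dot/=; ring.
rewrite nu !mulr0 => /eqP + /eqP; rewrite !subr_eq0 => /eqP + /eqP.
move: (dot n n) (dot (rot n) u) => d c h2 h1 d0.
by apply: pairP => /=; rewrite mulrAC -?h1 -?h2 mulfK.
Qed.

Definition halfplanes hs : set (R * R) :=
  [set p | forall h, h \in hs -> dot h.1 p <= h.2].

(** The cone spanned by the vectors [(v, 1)]: [r] records the total weight, so the slice [r = 1] is
    the convex hull of [s]. Homogenising allows one generator to be treated at a time. *)
Fixpoint cone s x (r : R) : Prop :=
  if s is v :: s' then exists2 t, 0 <= t & cone s' (x - smul t v) (r - t)
  else x = 0 /\ r = 0.

Lemma cone0 s : cone s 0 0.
Proof.
elim: s => //= v s IH; exists 0 => //.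
suff -> : (0 : R * R) - smul 0 v = 0 by rewrite subr0.
by apply: pairP => /=; rewrite mul0r subr0.
Qed.

Lemma cone_mem s v : v \in s -> cone s v 1.
Proof.
elim: s => //= a s IH; rewrite in_cons => /orP[/eqP <-|vs].
  exists 1 => //; rewrite subrr (_ : v - smul 1 v = 0); first exact: cone0.
  by apply: pairP => /=; rewrite mul1r subrr.
exists 0 => //; rewrite subr0 (_ : v - smul 0 a = v); first exact: IH.
by apply: pairP => /=; rewrite mul0r subr0.
Qed.

Lemma cone_ge0 s x r : cone s x r -> 0 <= r /\ (r = 0 -> x = 0).
Proof.
elim: s x r => [x r [-> ->]//|v s IH x r /= [t t0 /IH[rt E]]].
split; first by rewrite (le_trans t0)// -subr_ge0.
move=> r0; have t00 : t = 0 by lra.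
have := E (_ : r - t = 0); rewrite r0 t00 subrr => /(_ erefl) /eqP.
rewrite subr_eq0 => /eqP ->; apply: pairP => /=; ring.
Qed.

(** The witness is the maximum of 0 and of the lower bounds [a h / b h]; knowing where it is
    attained tells which combined constraint the elimination must invoke. *)
Lemma least_multiplier (T : eqType) (hs : seq T) (a b : T -> R) :
  exists t, [/\ 0 <= t, forall h, h \in hs -> 0 < b h -> a h <= t * b h &
    t = 0 \/ exists h, [/\ h \in hs, 0 < b h & a h = t * b h]].
Proof.
elim: hs => [|h hs [t [t0 lt tE]]]; first by exists 0; split => //; left.
have [bh|bh] := ltP 0 (b h); last first.
  exists t; split => //.
    by move=> k; rewrite in_cons => /orP[/eqP ->|/lt//]; rewrite ltNge bh.
  by case: tE => [|[k [k1 k2 k3]]]; [left|right; exists k; rewrite in_cons k1 orbT].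
have [ah|ah] := leP (a h) (t * b h).
  exists t; split => //.
    by move=> k; rewrite in_cons => /orP[/eqP ->|/lt//].
  by case: tE => [|[k [k1 k2 k3]]]; [left|right; exists k; rewrite in_cons k1 orbT].
have th : t < a h / b h by rewrite ltr_pdivlMr.
exists (a h / b h); split.
- by rewrite ltW// (le_lt_trans t0).
- move=> k; rewrite in_cons => /orP[/eqP ->|kh bk]; first by rewrite divfK ?gt_eqF.
  by rewrite (le_trans (lt _ kh bk))// ler_wpM2r ?ltW.
- by right; exists h; rewrite mem_head divfK ?gt_eqF.
Qed.

(* Fourier-Motzkin elimination of the coefficients of the generators. *)
Lemma cone_halfplanes s : exists hs, forall x r,
  cone s x r <-> forall h, h \in hs -> dot h.1 x <= h.2 * r.
Proof.
elim: s => [|v s [hs IH]].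
  exists [:: ((1, 0), 0); ((-1, 0), 0); ((0, 1), 0); ((0, -1), 0);
             ((0, 0), 1); ((0, 0), -1)] => x r; split.
    by move=> [-> ->] h _; rewrite /dot /= !mulr0 addr0.
  move=> H.
  have := H ((1, 0), 0); have := H ((-1, 0), 0); have := H ((0, 1), 0).
  have := H ((0, -1), 0); have := H ((0, 0), 1); have := H ((0, 0), -1).
  rewrite !inE !eqxx ?orbT /dot /=.
  move=> /(_ isT) h1 /(_ isT) h2 /(_ isT) h3 /(_ isT) h4 /(_ isT) h5 /(_ isT) h6.
  by split; [apply: pairP => /=|]; lra.
pose b (h : R * R * R) := dot h.1 v - h.2.
pose comb (h k : R * R * R) : R * R * R :=
  (smul (b h) k.1 - smul (b k) h.1, b h * k.2 - b k * h.2).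
(* Elimination of [t] from the inequalities [a h <= t * b h]: those with [0 < b h] bound [t] from
   below and are combined with those that bound it from above. Constraints with [b h <= 0] are kept,
   which for [b h < 0] is their combination with [0 <= t]. *)
exists ([seq h <- hs | b h <= 0] ++
  [seq comb h k | h <- [seq h <- hs | 0 < b h], k <- [seq h <- hs | b h < 0]]) => x r.
pose a (h : R * R * R) := dot h.1 x - h.2 * r.
have feas t (h : R * R * R) :
    (dot h.1 (x - smul t v) <= h.2 * (r - t)) = (a h <= t * b h).
  rewrite dotBr dotZr /a /b -subr_ge0 -[RHS]subr_ge0; congr (0 <= _); ring.
have combE (h k : R * R * R) : (dot (comb h k).1 x <= (comb h k).2 * r) =
    (b h * a k <= b k * a h).
  rewrite /comb /= /a -subr_ge0 -[RHS]subr_ge0; congr (0 <= _).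
  by rewrite /dot /=; ring.
split=> [/= [t t0 /IH H]|H].
  have {}H h : h \in hs -> a h <= t * b h by move=> /H; rewrite feas.
  move=> h; rewrite mem_cat => /orP[|/allpairsP[[h1 h2] /= []]].
    rewrite mem_filter => /andP[bh /H ah].
    by rewrite -subr_le0; apply: (le_trans ah); rewrite mulr_ge0_le0.
  rewrite !mem_filter => /andP[b1 /H a1] /andP[b2 /H a2] ->; rewrite combE.
  apply: (@le_trans _ _ (b h1 * (t * b h2))); first by rewrite ler_wpM2l// ltW.
  by rewrite mulrCA mulrA mulrC ler_wnM2l// ltW.
have [t [t0 lt tE]] := least_multiplier hs a b.
exists t => //; apply/IH => h hhs; rewrite feas.
have [bh|bh] := ltP 0 (b h); first exact: lt.
case: tE => [t00|[k [khs bk ak]]].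
  rewrite t00 mul0r subr_le0; apply: H.
  by rewrite mem_cat mem_filter bh hhs.
move: bh; rewrite le_eqVlt => /orP[/eqP bh|bh].
  rewrite bh mulr0 subr_le0; apply: H.
  by rewrite mem_cat mem_filter bh lexx hhs.
have := H (comb k h); rewrite combE mem_cat allpairs_f ?orbT; last 2 first.
- by rewrite mem_filter bk.
- by rewrite mem_filter bh.
by move=> /(_ isT); rewrite ak mulrA (mulrC _ (b k)) ler_pM2l// mulrC.
Qed.

End Plane.

(** * Convex hulls of finite sets *)

Section Hull.
Variable R : realType.
Implicit Types (p q n u v x : R * R) (s : seq (R * R)) (hs : seq (R * R * R)).

Lemma convex_set_conv (C : set (R * R)) (t r : R) p q :
  @convex_set R (R^o * R^o)%type C -> 0 <= t -> 0 <= r -> t + r = 1 ->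
  C p -> C q -> C (smul t p + smul r q).
Proof.
move=> cC t0 r0 tr /mem_set Cp /mem_set Cq.
have t1 : t <= 1 by lra.
have := cC p q (Itv01 t0 t1) Cp Cq; rewrite inE; congr C.
by have -> : r = 1 - t by lra.
Qed.

Lemma cone_convex (C : set (R * R)) s x (r : R) :
  @convex_set R (R^o * R^o)%type C -> (forall v, v \in s -> C v) ->
  cone s x r -> 0 < r -> C (smul r^-1 x).
Proof.
move=> cC; elim: s x r => [|v s IH] x r Cs /=; first by move=> [_ ->]; rewrite ltxx.
move=> [t t0 H] r0; have [rt0 rtE] := cone_ge0 H.
have Cv : C v by apply: Cs; rewrite mem_head.
have [E|E] := eqVneq (r - t) 0.
  suff -> : smul r^-1 x = v by [].
  have /eqP := rtE E; rewrite subr_eq0 => /eqP ->.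
  have <- : r = t by lra.
  by apply: pairP => /=; rewrite mulKf// gt_eqF.
have rt : 0 < r - t by rewrite lt_neqAle eq_sym E.
have {}IH : C (smul (r - t)^-1 (x - smul t v)).
  by apply: IH => // w ws; apply: Cs; rewrite in_cons ws orbT.
have -> : smul r^-1 x = smul ((r - t) / r) (smul (r - t)^-1 (x - smul t v)) +
    smul (t / r) v.
  by apply: pairP => /=; field; rewrite E gt_eqF.
apply: convex_set_conv => //; rewrite ?divr_ge0// ?ltW//.
by field; rewrite gt_eqF.
Qed.

Lemma halfplanes_convex hs : @convex_set R (R^o * R^o)%type (halfplanes hs).
Proof.
move=> p q l; rewrite !inE => Hp Hq h hhs.
have -> : (@conv R (convex_lmodType (R^o * R^o)%type) l p q : R * R) =
  smul l%:num p + smul (1 - l%:num) q by apply: pairP.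
rewrite dotDr !dotZr.
have := Hp _ hhs; have := Hq _ hhs.
have : 0 <= l%:num by []. have : l%:num <= 1 by [].
move: (l%:num) (dot _ _) (dot _ _) h.2 => t a b c t1 t0 ac bc.
rewrite -[c](_ : t * c + (1 - t) * c = c); last by ring.
by rewrite lerD// ler_wpM2l//; lra.
Qed.

Lemma convex_hull_halfplanes (V : set (R * R)) : finite_set V ->
  convex_hull V !=set0 ->
  exists hs D, [/\ convex_hull V = halfplanes hs,
    forall h, h \in hs -> h.1 != 0 &
    forall p, convex_hull V p -> `|p.1| <= D /\ `|p.2| <= D].
Proof.
move=> /finite_seqP [s ->] ne; have [hs Hs] := cone_halfplanes s.
have E x : halfplanes hs x <-> cone s x 1.
  split=> H; first by apply/Hs => h /H; rewrite mulr1.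
  by move=> h; move: h; move/Hs: H => H h /H; rewrite mulr1.
have hullE : convex_hull [set` s] = halfplanes hs.
  apply/seteqP; split => x.
    move=> H; apply: (H (halfplanes hs)); split; first exact: halfplanes_convex.
    by move=> v /= vs; apply/E/cone_mem.
  move=> /E Hx C [cC sC]; have := cone_convex cC sC Hx ltr01.
  by congr (C _); apply: pairP => /=; rewrite invr1 mul1r.
pose D : R := \sum_(v <- s) (`|v.1| + `|v.2|).
have sD v : v \in s -> `|v.1| <= D /\ `|v.2| <= D.
  move=> vs; rewrite /D (big_rem v)//=.
  have : 0 <= \sum_(v <- rem v s) (`|v.1| + `|v.2|).
    by apply: sumr_ge0 => i _; rewrite addr_ge0.
  have := normr_ge0 v.1; have := normr_ge0 v.2.
  move: (\sum_(_ <- _) _) `|_| `|_| => a b c; lra.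
(* The bounding square is itself an intersection of half-planes, hence convex, hence contains the
   hull. *)
pose bs : seq (R * R * R) :=
  [:: ((1, 0), D); ((-1, 0), D); ((0, 1), D); ((0, -1), D)].
have bD p : halfplanes bs p <-> `|p.1| <= D /\ `|p.2| <= D.
  rewrite !ler_norml; split=> [H|[/andP[h1 h2] /andP[h3 h4]] h].
    have := H ((1, 0), D); have := H ((-1, 0), D); have := H ((0, 1), D).
    have := H ((0, -1), D); rewrite !inE !eqxx ?orbT /dot /=.
    move=> /(_ isT) a /(_ isT) b /(_ isT) c /(_ isT) d.
    by split; apply/andP; split; lra.
  by rewrite !inE => /or4P[]/eqP ->; rewrite /dot /=; lra.
have hullD p : convex_hull [set` s] p -> `|p.1| <= D /\ `|p.2| <= D.
  move=> H; apply/bD; apply: (H (halfplanes bs)); split; first exact: halfplanes_convex.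
  by move=> v /= /sD /bD.
exists [seq h <- hs | h.1 != 0], D; split => //.
  rewrite hullE; apply/seteqP; split => p H h; first by rewrite mem_filter => /andP[_ /H].
  move=> hhs; have [h0|h0] := eqVneq h.1 0; last by apply: H; rewrite mem_filter h0.
  case: ne => p0; rewrite hullE => /(_ _ hhs); rewrite h0 /dot /= !mul0r; lra.
by move=> h; rewrite mem_filter => /andP[].
Qed.

Lemma convex_polygon_halfplanes (P : set (R * R)) : convex_polygon P ->
  exists hs D q r, [/\ P = halfplanes hs, forall h, h \in hs -> h.1 != 0,
    forall p, P p -> `|p.1| <= D /\ `|p.2| <= D, 0 < r &
    forall p, `|p.1 - q.1| < r -> `|p.2 - q.2| < r -> P p].
Proof.
move=> [[V finV ->] [q qr]]; have [|hs [D [E hs0 PD]]] := convex_hull_halfplanes finV.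
  by exists q; apply: interior_subset qr.
move: qr; rewrite /interior /= -nbhs_ballE => -[r /= r0 qr].
exists hs, D, q, r; split => // p p1 p2; apply: qr.
by split; rewrite /ball /= distrC.
Qed.

(** A constraint tight at [q] would fail a little further along its normal, still inside the square
    around [q]. *)
Lemma halfplanes_strict hs q (r : R) : 0 < r -> (forall h, h \in hs -> h.1 != 0) ->
  (forall p, `|p.1 - q.1| < r -> `|p.2 - q.2| < r -> halfplanes hs p) ->
  forall h, h \in hs -> dot h.1 q < h.2.
Proof.
move=> r0 hs0 Hq h hhs; have /dotnn_gt0 n0 := hs0 _ hhs.
pose e := r / (1 + `|h.1.1| + `|h.1.2|).
have a1 := normr_ge0 h.1.1; have a2 := normr_ge0 h.1.2.
have e0 : 0 < e by rewrite divr_gt0//; lra.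
have er : e * (1 + `|h.1.1| + `|h.1.2|) = r by rewrite divfK// gt_eqF//; lra.
clearbody e; have := Hq (q + smul e h.1) _ _ h hhs.
have -> : (q + smul e h.1).1 - q.1 = e * h.1.1 by rewrite /=; ring.
have -> : (q + smul e h.1).2 - q.2 = e * h.1.2 by rewrite /=; ring.
rewrite !normrM !(gtr0_norm e0) dotDr dotZr => H.
have : 0 < e * dot h.1 h.1 by rewrite mulr_gt0.
have {}H : dot h.1 q + e * dot h.1 h.1 <= h.2.
  by apply: H; rewrite -er ltr_pM2l//; lra.
by move: H; move: (e * _) => X; lra.
Qed.
End Hull.

(** * Half-open polygons and their faces *)

Section Half.
Variable R : realType.
Implicit Types (p q n u v w x z : R * R) (hs : seq (R * R * R)) (h : R * R * R).

(* The points [p] such that [p + s v] lies in the polygon for all small [s > 0],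
   provided that no side is parallel to [v]. *)
Definition half hs v : set (R * R) :=
  [set p | forall h, h \in hs ->
    dot h.1 p < h.2 \/ dot h.1 p = h.2 /\ dot h.1 v < 0].

(** Sides parallel to [u] are kept at both ends, so this contains the half-open polygons of the
    directions just to the left and just to the right of [u], each of which lacks one face. *)
Definition weak hs u : set (R * R) :=
  [set p | forall h, h \in hs ->
    dot h.1 p < h.2 \/ dot h.1 p = h.2 /\ dot h.1 u <= 0].

Definition tight hs n u : set (R * R) :=
  [set p | exists h, [/\ h \in hs, dot h.1 u = 0, 0 < dot h.1 n &
    dot h.1 p = h.2]].

(* The edge on the side of [n] parallel to [u], without its end point in
   direction [u]; it is empty if that edge is reduced to a vertex. *)
Definition face hs n u : set (R * R) := weak hs u `&` tight hs n u.

Definition generic hs v := forall h, h \in hs -> dot h.1 v != 0.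

Lemma weak_halfplanes hs u : weak hs u `<=` halfplanes hs.
Proof. by move=> p H h /H [/ltW//|[-> _]]. Qed.

Lemma half_halfplanes hs u : half hs u `<=` halfplanes hs.
Proof. by move=> p H h /H [/ltW//|[-> _]]. Qed.

Lemma small_all (T : eqType) (s : seq T) (Q : T -> R -> Prop) :
  (forall a, a \in s -> exists2 e, 0 < e & forall d, 0 < d -> d <= e -> Q a d) ->
  exists2 e, 0 < e & forall d, 0 < d -> d <= e -> forall a, a \in s -> Q a d.
Proof.
elim: s => [_|a s IH H]; first by exists 1.
have [|e e0 He] := IH; first by move=> b bs; apply: H; rewrite in_cons bs orbT.
have [e' e'0 He'] := H a (mem_head _ _).
exists (Num.min e e'); first by rewrite lt_min e0.
move=> d d0; rewrite le_min => /andP[de de'] b.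
by rewrite in_cons => /orP[/eqP ->|/(He _ d0 de)//]; apply: He'.
Qed.

(** A strict inequality survives a small move, and a tight one is decided by the sign of
    [dot h.1 v], which [v'] shares. Letting [v'] vary makes the points [p + smul s v'] fill an open
    set, which a null set cannot contain. *)
Lemma half_near hs v p : generic hs v ->
  exists2 e, 0 < e & forall d, 0 < d -> d <= e ->
    forall s v', 0 < s -> s < d -> `|v'.1 - v.1| < d -> `|v'.2 - v.2| < d ->
    halfplanes hs (p + smul s v') <-> half hs v p.
Proof.
move=> gv; pose Q h (d : R) := forall s v', 0 < s -> s < d ->
  `|v'.1 - v.1| < d -> `|v'.2 - v.2| < d ->
  dot h.1 (p + smul s v') <= h.2 <->
  dot h.1 p < h.2 \/ dot h.1 p = h.2 /\ dot h.1 v < 0.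
have [h hhs|e e0 He] := @small_all _ hs Q; last first.
  exists e => // d d0 de s v' s0 sd v1 v2.
  by split=> H h hhs; have := He _ d0 de _ hhs _ _ s0 sd v1 v2;
    have := H _ hhs; tauto.
have := gv _ hhs; set a := dot h.1 v => a0.
set N := `|h.1.1| + `|h.1.2|; set g := dot h.1 p - h.2.
have N0 : 0 <= N by rewrite addr_ge0.
have aa : 0 < `|a| by rewrite normr_gt0.
(* [e1] keeps [dot h.1 v'] within half of [|a|] of [a], hence of the same sign. [e2] keeps the move
   too short to reach the line of [h]; it takes the default 1 when [p] lies on that line. *)
pose e1 := `|a| / (2 * (N + 1)).
have e10 : 0 < e1 by rewrite divr_gt0//; lra.
have e1E : e1 * (2 * (N + 1)) = `|a| by rewrite divfK// gt_eqF//; lra.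
pose e2 := if g == 0 then 1 else `|g| / (2 * `|a|).
have e20 : 0 < e2.
  by rewrite /e2; case: eqP => // /eqP g0; rewrite divr_gt0 ?normr_gt0//; lra.
exists (Num.min e1 e2); first by rewrite lt_min e10.
move=> d d0; rewrite le_min => /andP[d1 d2] s v' s0 sd v1 v2.
set b := dot h.1 v'.
have ba : `|b - a| <= `|a| / 2.
  have -> : b - a = h.1.1 * (v'.1 - v.1) + h.1.2 * (v'.2 - v.2).
    by rewrite /a /b /dot; ring.
  apply: (le_trans (ler_normD _ _)); rewrite !normrM.
  have d1' : d * (2 * (N + 1)) <= `|a| by rewrite -e1E ler_wpM2r//; lra.
  have : `|h.1.1| * `|v'.1 - v.1| <= `|h.1.1| * d by rewrite ler_wpM2l// ltW.
  have : `|h.1.2| * `|v'.2 - v.2| <= `|h.1.2| * d by rewrite ler_wpM2l// ltW.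
  move: d1'; rewrite /N; move: (_ * `|_|) (_ * `|_|) => X Y; nra.
have -> : dot h.1 (p + smul s v') = h.2 + (g + s * b).
  by rewrite dotDr dotZr /g /b; ring.
rewrite gerDl.
have -> : dot h.1 p = h.2 + g by rewrite /g addrC subrK.
rewrite gtrDl -/a.
have [g0|g0] := eqVneq g 0.
  rewrite g0 add0r addr0 ltxx pmulr_rle0//.
  move: ba; rewrite ler_norml; move: aa; have [a1|a1] := ltP 0 a.
    rewrite (gtr0_norm a1) => _ /andP[b1 b2]; split=> [b0|]; first by exfalso; lra.
    by case=> // -[_ ?]; lra.
  rewrite (ler0_norm a1) => a2 /andP[b1 b2]; split=> _; last lra.
  by right; split => //; lra.
have gs : s * (2 * `|a|) < `|g|.
  apply: (@lt_le_trans _ _ (e2 * (2 * `|a|))).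
    by rewrite ltr_pM2r; [apply: lt_le_trans d2|lra].
  by rewrite /e2 (negbTE g0) divfK// gt_eqF//; lra.
have sb : `|s * b| < `|g|.
  rewrite normrM (gtr0_norm s0); apply: le_lt_trans gs.
  rewrite ler_pM2l//; have := ler_normB (b - a) (- a); rewrite opprK subrK normrN.
  by move: ba aa; move: `|_| `|_| `|_| => X Y Z; lra.
move: sb; rewrite ltr_norml => /andP[].
have [g1|g1] := ltP 0 g.
  rewrite (gtr0_norm g1) => *; split; first by lra.
  by case=> [|[/eqP]]; [lra|rewrite -subr_eq0 addrAC subrr add0r (negbTE g0)].
by rewrite (ler0_norm g1) => *; split => [_|]; [left; rewrite lt_neqAle g0|lra].
Qed.

(** Only forward steps are covered: a point on a side through which [v] enters belongs to the set,
    but the points just before it do not. Backward steps are made later with [- v]. *)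
Lemma half_step hs v p : generic hs v ->
  exists2 e, 0 < e & forall d, 0 < d -> d <= e ->
    half hs v (p + smul d v) <-> half hs v p.
Proof.
move=> gv; pose Q h (d : R) :=
  (dot h.1 (p + smul d v) < h.2 \/ dot h.1 (p + smul d v) = h.2 /\ dot h.1 v < 0) <->
  (dot h.1 p < h.2 \/ dot h.1 p = h.2 /\ dot h.1 v < 0).
have [h hhs|e e0 He] := @small_all _ hs Q; last first.
  exists e => // d d0 de.
  by split=> H h hhs; have := He _ d0 de _ hhs; have := H _ hhs; rewrite /Q; tauto.
have := gv _ hhs; set a := dot h.1 v => a0.
set g := h.2 - dot h.1 p.
have aa : 0 < `|a| by rewrite normr_gt0.
pose e2 := if g == 0 then 1 else `|g| / (2 * `|a|).
have e20 : 0 < e2.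
  by rewrite /e2; case: eqP => // /eqP g0; rewrite divr_gt0 ?normr_gt0//; lra.
exists e2 => // d d0 d2; rewrite /Q dotDr dotZr -/a.
have [g0|g0] := eqVneq g 0.
  have -> : h.2 = dot h.1 p by move: g0; rewrite /g => ?; lra.
  rewrite ltxx gtrDl pmulr_rlt0//; split; first by case=> [|[]]; right.
  by case=> // -[_ ?]; left.
have gs : d * (2 * `|a|) <= `|g|.
  apply: (@le_trans _ _ (e2 * (2 * `|a|))); first by rewrite ler_wpM2r//; lra.
  by rewrite /e2 (negbTE g0) divfK// gt_eqF//; lra.
have da : `|d * a| < `|g|.
  rewrite normrM (gtr0_norm d0).
  have : 0 < d * `|a| by rewrite mulr_gt0.
  by move: gs; rewrite mulrCA; move: (d * `|a|) => X; lra.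
move: da; rewrite ltr_norml => /andP[].
have [g1|g1] := ltP 0 g.
  rewrite (gtr0_norm g1) /g => h1 h2; move: g1; rewrite /g => g1.
  by split=> _; left; lra.
have {}g1 : g < 0 by rewrite lt_neqAle g0.
rewrite (ltr0_norm g1) => h1 h2; move: g1 h1 h2; rewrite /g => g1 h1 h2.
by split; case=> [?|[? _]]; lra.
Qed.

(** A small turn keeps the sign of [dot h.1 u] for the sides not parallel to [u]; for the parallel
    ones the sign becomes that of [dot h.1 z], so exactly the side towards [z] is lost. *)
Lemma half_turn hs u z :
  (forall h, h \in hs -> dot h.1 u = 0 -> dot h.1 z != 0) ->
  exists2 e, 0 < e & forall d, 0 < d -> d <= e ->
    generic hs (u + smul d z) /\
    forall p, half hs (u + smul d z) p <-> weak hs u p /\ ~ tight hs z u p.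
Proof.
move=> uz; pose Q h (d : R) := [/\ dot h.1 (u + smul d z) != 0,
  dot h.1 u = 0 -> (dot h.1 (u + smul d z) < 0) = (dot h.1 z < 0) &
  dot h.1 u != 0 -> (dot h.1 (u + smul d z) < 0) = (dot h.1 u <= 0)].
have [h hhs|e e0 He] := @small_all _ hs Q; last first.
  exists e => // d d0 de; split; first by move=> h hhs; case: (He _ d0 de _ hhs).
  move=> p; split=> [H|[W T] h hhs].
    split.
      move=> h hhs; have [_ h1 h2] := He _ d0 de _ hhs.
      have [|[-> H']] := H _ hhs; [by left|right; split => //].
      by have [->//|u0] := eqVneq (dot h.1 u) 0; rewrite -h2.
    move=> [h [hhs hu hz hp]]; have [_ h1 _] := He _ d0 de _ hhs.
    by have := H _ hhs; rewrite hp ltxx h1// => -[//|[_]]; rewrite ltNge ltW.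
  have [_ h1 h2] := He _ d0 de _ hhs.
  have [|[hp H']] := W _ hhs; [by left|right; split => //].
  have [u0|u0] := eqVneq (dot h.1 u) 0; last by rewrite h2.
  rewrite h1// ltNge; apply/negP => z0; apply: T; exists h; split => //.
  by rewrite lt_neqAle eq_sym uz.
have [u0|u0] := eqVneq (dot h.1 u) 0.
  exists 1 => // d d0 _; rewrite /Q dotDr dotZr u0 add0r; split => //.
  - by rewrite mulf_neq0 ?uz// gt_eqF.
  - by move=> _; rewrite pmulr_rlt0.
  - by rewrite eqxx.
have uu : 0 < `|dot h.1 u| by rewrite normr_gt0.
exists (`|dot h.1 u| / (2 * (`|dot h.1 z| + 1))).
  by rewrite divr_gt0// mulr_gt0// ltr_wpDl.
move=> d d0; rewrite ler_pdivlMr ?mulr_gt0 ?ltr_wpDl// => dd.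
rewrite /Q dotDr dotZr.
have : `|d * dot h.1 z| < `|dot h.1 u|.
  rewrite normrM (gtr0_norm d0); move: dd; move: `|dot h.1 z| `|_| (normr_ge0 (dot h.1 z)) uu.
  move=> X Y X0 Y0; nra.
rewrite ltr_norml => /andP[].
have [g1|g1] := ltP 0 (dot h.1 u).
  rewrite (gtr0_norm g1) => h1 h2; split.
  - by rewrite gt_eqF//; lra.
  - by move=> E; rewrite E ltxx in g1.
  - by move=> _; apply/negbTE; rewrite -leNgt; lra.
rewrite (ler0_norm g1) => h1 h2; split.
- by rewrite lt_eqF//; lra.
- by move=> E; rewrite E eqxx in u0.
- by move=> _; lra.
Qed.

Lemma parallel_smul u w : u != 0 -> u.1 * w.2 = u.2 * w.1 ->
  w = smul (dot u w / dot u u) u.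
Proof.
move=> u0 E; have d0 : dot u u != 0 by rewrite gt_eqF// dotnn_gt0.
have : w.1 * dot u u - dot u w * u.1 = u.2 * (u.2 * w.1 - u.1 * w.2) by rewrite /dot; ring.
have : w.2 * dot u u - dot u w * u.2 = u.1 * (u.1 * w.2 - u.2 * w.1) by rewrite /dot; ring.
rewrite E !subrr !mulr0 => /eqP + /eqP; rewrite !subr_eq0 => /eqP + /eqP.
move: (dot u u) (dot u w) d0 => d c d0 h2 h1.
by apply: pairP => /=; rewrite mulrAC -?h1 -?h2 mulfK.
Qed.

Lemma dot0_parallel n u w : n != 0 -> dot n u = 0 -> dot n w = 0 ->
  u.1 * w.2 = u.2 * w.1.
Proof.
move=> n0; have [n1|n1] := eqVneq n.1 0.
  have n2 : n.2 != 0 by apply: contra n0 => /eqP n2; apply/eqP; apply: pairP.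
  rewrite /dot n1 !mul0r !add0r => /eqP; rewrite mulf_eq0 (negbTE n2) => /eqP ->.
  by move=> /eqP; rewrite mulf_eq0 (negbTE n2) => /eqP ->; rewrite mulr0 mul0r.
rewrite /dot => h1 h2; apply: (mulfI n1).
have -> : n.1 * (u.1 * w.2) = (n.1 * u.1 + n.2 * u.2) * w.2 - n.2 * u.2 * w.2 by ring.
rewrite h1.
have -> : n.1 * (u.2 * w.1) = u.2 * (n.1 * w.1 + n.2 * w.2) - n.2 * u.2 * w.2 by ring.
by rewrite h2 mul0r mulr0.
Qed.

Lemma dot0_smul n u w : n != 0 -> u != 0 -> dot n u = 0 -> dot n w = 0 ->
  w = smul (dot u w / dot u u) u.
Proof. by move=> n0 u0 nu nw; apply: parallel_smul => //; apply: dot0_parallel nw. Qed.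

Lemma dotC p q : dot p q = dot q p.
Proof. by rewrite /dot; ring. Qed.
End Half.

(** * Faces are half-open segments *)

Section Face.
Variable R : realType.
Implicit Types (p q n u v w x z : R * R) (hs : seq (R * R * R)) (h : R * R * R).

Lemma face_scale hs n u (c d : R) : 0 < c -> 0 < d ->
  face hs (smul c n) (smul d u) = face hs n u.
Proof.
move=> c0 d0; apply/seteqP; split=> p [W [h [hhs hu hn hp]]]; split.
- by move=> k /W; rewrite dotZr pmulr_rle0.
- exists h; move: hu hn; rewrite !dotZr pmulr_rgt0// => /eqP.
  by rewrite mulf_eq0 gt_eqF//= => /eqP.
- by move=> k /W; rewrite dotZr pmulr_rle0.
- by exists h; rewrite !dotZr hu mulr0 mulr_gt0.
Qed.

Lemma smulDl (a b : R) u : smul (a + b) u = smul a u + smul b u.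
Proof. by apply: pairP => /=; ring. Qed.

Lemma smulA (a b : R) u : smul (a * b) u = smul a (smul b u).
Proof. by apply: pairP => /=; ring. Qed.

Lemma smulN (a : R) u : smul (- a) u = - smul a u.
Proof. by apply: pairP => /=; ring. Qed.

Lemma forall_mem_cons (T : eqType) (a : T) (s : seq T) (Q : T -> Prop) :
  (forall b, b \in a :: s -> Q b) <-> Q a /\ forall b, b \in s -> Q b.
Proof.
split=> [H|[Qa H] b]; last by rewrite in_cons => /orP[/eqP ->|/H].
by split=> [|b bs]; apply: H; rewrite in_cons ?eqxx ?bs ?orbT.
Qed.

(* Both orientations at once, so that they get the same end points. *)
Lemma interval_constraints (hs : seq (R * R * R)) u p0 (B : R) :
  exists al be, forall s,
    ((forall h, h \in hs -> dot h.1 u != 0 ->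
        dot h.1 (p0 + smul s u) < h.2 \/
        dot h.1 (p0 + smul s u) = h.2 /\ dot h.1 u < 0) /\
     - B <= s /\ s < B <-> al <= s /\ s < be) /\
    ((forall h, h \in hs -> dot h.1 u != 0 ->
        dot h.1 (p0 + smul s u) < h.2 \/
        dot h.1 (p0 + smul s u) = h.2 /\ 0 < dot h.1 u) /\
     - B < s /\ s <= B <-> al < s /\ s <= be).
Proof.
elim: hs => [|h hs [al [be IH]]]; first by exists (- B), B => s; split; split => [[]|].
suff [al' [be' H]] : exists al' be', forall s,
    ((dot h.1 u != 0 -> dot h.1 (p0 + smul s u) < h.2 \/
        dot h.1 (p0 + smul s u) = h.2 /\ dot h.1 u < 0) /\
     al <= s /\ s < be <-> al' <= s /\ s < be') /\
    ((dot h.1 u != 0 -> dot h.1 (p0 + smul s u) < h.2 \/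
        dot h.1 (p0 + smul s u) = h.2 /\ 0 < dot h.1 u) /\
     al < s /\ s <= be <-> al' < s /\ s <= be').
  have step (C F I S S' : Prop) : (F /\ I <-> S) -> (C /\ S <-> S') ->
    ((C /\ F) /\ I <-> S') by tauto.
  exists al', be' => s; rewrite !forall_mem_cons; have [IH1 IH2] := IH s.
  by have [H1 H2] := H s; split; [apply: step IH1 H1|apply: step IH2 H2].
have [u0|u0] := eqVneq (dot h.1 u) 0; first by exists al, be => s; split; split=> [[]|].
pose t := (h.2 - dot h.1 p0) / dot h.1 u.
have sol s : dot h.1 (p0 + smul s u) - h.2 = (s - t) * dot h.1 u.
  by rewrite dotDr dotZr /t; field.
have eE s : dot h.1 (p0 + smul s u) = h.2 <-> s = t.
  split=> [/eqP|st]; last by apply/eqP; rewrite -subr_eq0 sol st subrr mul0r.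
  by rewrite -subr_eq0 sol mulf_eq0 (negbTE u0) orbF subr_eq0 => /eqP.
have [hu|hu] := ltP (dot h.1 u) 0.
  have lE s : dot h.1 (p0 + smul s u) < h.2 <-> t < s.
    by rewrite -subr_lt0 sol nmulr_llt0// subr_gt0.
  exists (Num.max al t), be => s; rewrite eE lE ge_max gt_max.
  split; split.
  - by move=> [/(_ isT) H [h1 h2]]; split=> //; apply/andP; split; case: H => [|[]]; lra.
  - move=> [/andP[h1 h2] h3]; split=> // _.
    by have [->|] := eqVneq s t; [right|left; rewrite lt_neqAle eq_sym h2 andbT].
  - by move=> [/(_ isT) H [h1 h2]]; split=> //; apply/andP; split; case: H => [|[]]; lra.
  - by move=> [/andP[h1 h2] h3]; split=> // _; left.
have {}hu : 0 < dot h.1 u by rewrite lt_neqAle eq_sym u0.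
have lE s : dot h.1 (p0 + smul s u) < h.2 <-> s < t.
  by rewrite -subr_lt0 sol pmulr_llt0// subr_lt0.
exists al, (Num.min be t) => s; rewrite eE lE lt_min le_min.
split; split.
- by move=> [/(_ isT) H [h1 h2]]; split=> //; apply/andP; split; case: H => [|[]]; lra.
- by move=> [h1 /andP[h2 h3]]; split=> // _; left.
- by move=> [/(_ isT) H [h1 h2]]; split=> //; apply/andP; split; case: H => [|[]]; lra.
- move=> [h1 /andP[h2 h3]]; split=> // _.
  by have [->|] := eqVneq s t; [right|left; rewrite lt_neqAle h3 andbT].
Qed.

(** [hs] may contain several parallel constraints. Those orthogonal to [u] on the side of [n] have
    positive multiples of [n] as normals, so every tight point maximises [dot n] over the
    polygon. *)
Lemma tight_line hs n u p q : n != 0 -> u != 0 -> dot n u = 0 ->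
  halfplanes hs p -> halfplanes hs q -> tight hs n u p -> tight hs n u q ->
  dot n p = dot n q.
Proof.
move=> n0 u0 nu Hp Hq [h [hhs hu hn hp]] [k [khs ku kn kq]].
have nn := dotnn_gt0 n0.
have multE m : dot m u = 0 -> m = smul (dot n m / dot n n) n.
  by move=> mu; apply: (@dot0_smul _ u) => //; rewrite dotC.
have aux m (r : R) x y : dot m u = 0 -> 0 < dot m n -> dot m x = r -> dot m y <= r ->
    dot n y <= dot n x.
  move=> /multE mE mn mx my; move: my; rewrite -mx mE !dotZl ler_pM2l//.
  by rewrite divr_gt0// dotC.
by apply/eqP; rewrite eq_le (aux k.1 k.2)// ?(aux h.1 h.2)// ?Hp ?Hq.
Qed.

(** On the line of the side, each half-plane not parallel to it bounds the parameter at one end,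
    open or closed according to the orientation. Reversing [u] swaps the open and the closed end
    without changing [a] and [l], which is what later allows the two versions to be subtracted. *)
Lemma face_segment hs n u (D : R) : n != 0 -> u != 0 -> dot n u = 0 ->
  (forall p, halfplanes hs p -> `|p.1| <= D /\ `|p.2| <= D) ->
  exists a l, [/\ 0 <= l,
    forall p, face hs n u p <-> exists s, [/\ 0 <= s, s < l & p = a + smul s u] &
    forall p, face hs n (- u) p <-> exists s, [/\ 0 < s, s <= l & p = a + smul s u]].
Proof.
move=> n0 u0 nu PD.
have NuE p : tight hs n (- u) p <-> tight hs n u p.
  split=> -[h [h1 h2 h3 h4]]; exists h; split => //; last by rewrite dotNr h2 oppr0.
  by rewrite -[u]opprK dotNr h2 oppr0.
have [[p0 [Hp0 Tp0]]|ne] := pselect (exists p0, halfplanes hs p0 /\ tight hs n u p0);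
    last first.
  exists 0, 0; split => // p; split.
  - by move=> [/weak_halfplanes Hp Tp]; exfalso; apply: ne; exists p.
  - by move=> [s [s0 s1]]; exfalso; lra.
  - by move=> [/weak_halfplanes Hp /NuE Tp]; exfalso; apply: ne; exists p.
  - by move=> [s [s0 s1]]; exfalso; lra.
have uu := dotnn_gt0 u0.
(* A point [p] of the face has parameter [dot u (p - p0) / dot u u], and the coordinates of [p - p0]
   are at most [2 * D]. The added 1 keeps all these parameters strictly between [- B] and [B], so
   the artificial bounds never cut the face. *)
pose B := 2 * D * (`|u.1| + `|u.2|) / dot u u + 1.
have [al [be Hs]] := interval_constraints hs u p0 B.
have onl p : halfplanes hs p -> tight hs n u p -> exists2 s, p = p0 + smul s u &
    - B < s < B.
  move=> Hp Tp; have E : dot n (p - p0) = 0.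
    by rewrite dotBr (tight_line n0 u0 nu Hp Hp0 Tp Tp0) subrr.
  have := dot0_smul n0 u0 nu E; set s := (X in smul X) => sE.
  exists s; first by rewrite -sE addrC subrK.
  rewrite -ltr_norml /B; apply: ltr_pwDr => //.
  rewrite /s normrM normfV (gtr0_norm uu) ler_pM2r ?invr_gt0//.
  have [] := PD _ Hp; have [] := PD _ Hp0 => d1 d2 d3 d4.
  rewrite /dot /=; apply: (le_trans (ler_normD _ _)); rewrite !normrM.
  have e1 : `|p.1 - p0.1| <= 2 * D by apply: (le_trans (ler_normB _ _)); lra.
  have e2 : `|p.2 - p0.2| <= 2 * D by apply: (le_trans (ler_normB _ _)); lra.
  by rewrite mulrDr lerD// mulrC ler_wpM2r.
have onf s v : (v = u \/ v = - u) -> face hs n v (p0 + smul s u) <->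
    (forall h, h \in hs -> dot h.1 u != 0 -> dot h.1 (p0 + smul s u) < h.2 \/
        dot h.1 (p0 + smul s u) = h.2 /\ dot h.1 v < 0).
  move=> vu; have v0 h : (dot h.1 v == 0) = (dot h.1 u == 0).
    by case: vu => ->; rewrite // dotNr oppr_eq0.
  split=> [[W _] h hhs hu|H].
    have [|[e1]] := W h hhs; [by left|rewrite le_eqVlt v0 (negbTE hu) /=].
    by right.
  split.
    move=> h hhs; have [hu|hu] := eqVneq (dot h.1 u) 0.
      rewrite dotDr dotZr hu mulr0 addr0.
      have := Hp0 h hhs; rewrite le_eqVlt => /orP[/eqP e|]; last by left.
      by right; split => //; rewrite le_eqVlt v0 hu eqxx.
    by have [|[-> /ltW]] := H h hhs hu; [left|right].
  have : tight hs n u (p0 + smul s u).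
    case: Tp0 => h [h1 h2 h3 h4]; exists h; split=> //.
    by rewrite dotDr dotZr h2 mulr0 addr0.
  by case: vu => -> //; rewrite NuE.
have [ab|ab] := leP be al.
  exists 0, 0; split => // p; split; try by move=> [s [s0 s1]]; exfalso; lra.
  - move=> F; have [s pE /andP[s1 s2]] := onl _ (weak_halfplanes F.1) F.2.
    move: F; rewrite pE onf; last by left.
    move=> H; have [h _] := Hs s; case: h => h _.
    by have [] := h (conj H (conj (ltW s1) s2)); lra.
  - move=> F; have [s pE /andP[s1 s2]] := onl _ (weak_halfplanes F.1) ((NuE _).1 F.2).
    move: F; rewrite pE onf; last by right.
    move=> H; have [_ [h _]] := Hs s.
    have [|] := h _; last lra; split; last by split; [|exact: ltW].
    by move=> k k1 k2; have := H k k1 k2; rewrite dotNr oppr_lt0.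
exists (p0 + smul al u), (be - al); split; first by rewrite subr_ge0 ltW.
- move=> p; split=> [F|[s [s0 s1 ->]]].
    have [s pE /andP[s1 s2]] := onl _ (weak_halfplanes F.1) F.2.
    move: F; rewrite pE onf; last by left.
    move=> H; have [h _] := Hs s; case: h => h _.
    have [h1 h2] := h (conj H (conj (ltW s1) s2)).
    exists (s - al); clear pE; split; [lra|lra|].
    by rewrite -addrA -smulDl [al + _]addrC subrK.
  rewrite -addrA -smulDl onf; last by left.
  have [[_ h] _] := Hs (al + s); apply: (h _).1.
  by split; lra.
- move=> p; split=> [F|[s [s0 s1 ->]]].
    have [s pE /andP[s1 s2]] := onl _ (weak_halfplanes F.1) ((NuE _).1 F.2).
    move: F; rewrite pE onf; last by right.
    move=> H; have [_ [h _]] := Hs s.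
    have [|h1 h2] := h _.
      split; last by split; [|exact: ltW].
      by move=> k k1 k2; have := H k k1 k2; rewrite dotNr oppr_lt0.
    exists (s - al); clear pE; split; [lra|lra|].
    by rewrite -addrA -smulDl [al + _]addrC subrK.
  rewrite -addrA -smulDl onf; last by right.
  have [_ [_ h]] := Hs (al + s).
  have [|{}h _] := h; first by split; lra.
  by move=> k k1 k2; have := h k k1 k2; rewrite dotNr oppr_lt0.
Qed.
End Face.

(** * Averaging operators *)

Section Averages.
Variable R : realType.

Definition bdd (T : Type) (f : T -> R) := exists C, forall x, `|f x| <= C.

Lemma bddZD (T : Type) (a : R) (f g : T -> R) : bdd f -> bdd g ->
  bdd (fun x => a * f x + g x).
Proof.
move=> [C fC] [D gD]; exists (`|a| * C + D) => x.
by rewrite (le_trans (ler_normD _ _))// normrM lerD// ler_wpM2l.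
Qed.

Lemma bdd_comp (S T : Type) (h : S -> T) (f : T -> R) : bdd f -> bdd (f \o h).
Proof. by move=> [C fC]; exists C => x; apply: fC. Qed.

Lemma bdd_cst (T : Type) (c : R) : bdd (fun _ : T => c).
Proof. by exists `|c|. Qed.

Definition cesaro (u : nat -> R) : nat -> R :=
  fun n => (\sum_(i < n.+1) u i) / n.+1%:R.

Lemma cesaro_bound (u : nat -> R) (C : R) n : (forall i, `|u i| <= C) ->
  `|cesaro u n| <= C.
Proof.
move=> uC; rewrite /cesaro normrM normfV normr_nat ler_pdivrMr//.
apply: (le_trans (ler_norm_sum _ _ _)).
apply: (@le_trans _ _ (\sum_(i < n.+1) C)); first exact: ler_sum.
by rewrite sumr_const card_ord mulr_natr.
Qed.

Lemma cesaroZD a (u v : nat -> R) :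
  cesaro (fun n => a * u n + v n) = (fun n => a * cesaro u n + cesaro v n).
Proof.
apply/funext => n; rewrite /cesaro big_split /= -mulr_sumr mulrDl; ring.
Qed.

(** Banach limits, constrained on bounded sequences only. *)
Definition mean (M : (nat -> R) -> R) := [/\
  forall a u v, bdd u -> bdd v -> M (fun n => a * u n + v n) = a * M u + M v,
  forall u v, bdd u -> bdd v -> (forall n, u n <= v n) -> M u <= M v,
  forall c, M (fun=> c) = c &
  forall u, bdd u -> M (fun n => u n.+1) = M u].

Lemma ultra_bdd_cvg (U : set_system nat) (u : nat -> R) :
  UltraFilter U -> bdd u -> exists l : R, u @ U --> l.
Proof.
move=> UU [C uC]; have [|l [_ cl]] := @segment_compact R (- C) C (u @ U) (fmap_proper_filter u _).
  by apply: (@filterE _ U) => n; rewrite /= in_itv /= -ler_norml; apply: uC.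
exists l => B Bl; have [//|UB] := in_ultra_setVsetC (u @^-1` B) UU.
by have [x []] := cl (~` B) B UB Bl.
Qed.

(** An ultrafilter makes every bounded sequence converge, and Cesaro means make the limit
    shift-invariant: the means of a sequence and of its shift differ by a telescoped term of order
    [1 / n]. This term vanishes because the ultrafilter refines the filter of neighbourhoods of
    infinity. *)
Lemma mean_exists : exists M, mean M.
Proof.
have [U [UU sU]] := ultraFilterLemma eventually_filter.
pose M u : R := lim (cesaro u @ U).
have cvgM u : bdd u -> cesaro u @ U --> M u.
  move=> [C uC]; have [|l cl] := @ultra_bdd_cvg U (cesaro u) UU.
    by exists C => n; apply: cesaro_bound.
  by rewrite /M (cvg_lim _ cl).
exists M; split.
- move=> a u v bu bv; apply: cvg_lim => //.
  rewrite cesaroZD; apply: cvgD; last exact: cvgM.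
  by apply: cvgMl_tmp; exact: cvgM.
- move=> u v bu bv uv; apply: (ler_cvg_to (cvgM _ bu) (cvgM _ bv)).
  apply: filterE => n; rewrite /cesaro ler_pM2r ?invr_gt0//.
  by apply: ler_sum => i _; apply: uv.
- move=> c; apply: cvg_lim => //.
  have -> : cesaro (fun=> c) = fun=> c; last exact: cvg_cst.
  by apply/funext => n; rewrite /cesaro sumr_const card_ord -(mulr_natr c) mulfK.
- move=> u bu; have bSu : bdd (fun n => u n.+1) by apply: (@bdd_comp _ _ succn).
  apply/eqP; rewrite -subr_eq0; apply/eqP.
  have h1 : (cesaro (fun n => u n.+1) - cesaro u) @ U -->
    M (fun n => u n.+1) - M u by apply: cvgB; apply: cvgM.
  suff h2 : (cesaro (fun n => u n.+1) - cesaro u) @ U --> (0 : R).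
    by have e1 := cvg_lim (@Rhausdorff R) h1; rewrite -e1; exact: cvg_lim h2.
  case: bu => C uC.
  have diffE n : cesaro (fun n => u n.+1) n - cesaro u n = (u n.+1 - u 0) / n.+1%:R.
    rewrite /cesaro -mulrBl; congr (_ / _).
    rewrite big_ord_recr /= [X in _ - X]big_ord_recl /=.
    rewrite (eq_bigr (fun i : 'I_n => u (bump 0 i))); last by [].
    ring.
  have lim0 : (fun n => 2 * C * (n.+1%:R^-1 : R)) @ U --> (0 : R).
    have : (fun n => 2 * C * (n.+1%:R^-1 : R)) @ \oo --> (2 * C * 0 : R).
      by apply: cvgMl_tmp; exact: cvg_harmonic.
    by rewrite mulr0 => h; apply: cvg_trans h => A; apply: sU.
  have lim0' : (fun n => - (2 * C * (n.+1%:R^-1 : R))) @ U --> (0 : R).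
    by rewrite -oppr0; apply: cvgN.
  apply: squeeze_cvgr lim0' lim0; apply: filterE => n.
  rewrite -ler_norml /= -[X in `|X|]/(cesaro (fun n => u n.+1) n - cesaro u n) diffE.
  rewrite normrM normfV normr_nat ler_pM2r ?invr_gt0//.
  by rewrite (le_trans (ler_normB _ _))//; have := uC n.+1; have := uC 0; lra.
Qed.

Variable V : zmodType.
Implicit Types (f g : V -> R) (v h x : V) (A B : (V -> R) -> V -> R).

(** Only the properties that pass to compositions are kept; the periods gained along the way are
    tracked separately. *)
Definition averaging A := [/\
  forall a f g, bdd f -> bdd g ->
    forall x, A (fun y => a * f y + g y) x = a * A f x + A g x,
  forall f g, bdd f -> bdd g -> (forall x, f x <= g x) -> forall x, A f x <= A g x,
  forall f h, bdd f -> forall x, A (fun y => f (y + h)) x = A f (x + h) &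
  forall c x, A (fun=> c) x = c].

Lemma averaging_bdd A f : averaging A -> bdd f -> bdd (A f).
Proof.
move=> [_ Ale _ Ac] [C fC]; exists C => x; rewrite ler_norml; apply/andP.
have bf : bdd f by exists C.
split; [rewrite -(Ac (- C) x)|rewrite -[leRHS](Ac C x)]; apply: Ale => //;
  try exact: bdd_cst; by move=> y; have := fC y; rewrite ler_norml => /andP[].
Qed.

Lemma averaging_comp A B : averaging A -> averaging B -> averaging (A \o B).
Proof.
move=> aA aB; have [A1 A2 A3 A4] := aA; have [B1 B2 B3 B4] := aB; split.
- move=> a f g bf bg x /=; rewrite -A1; try exact: averaging_bdd.
  by congr (A _ x); apply/funext => y; rewrite B1.
- move=> f g bf bg fg x /=; apply: A2; try exact: averaging_bdd.
  by move=> y; apply: B2.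
- move=> f h bf x /=; rewrite -A3; last exact: averaging_bdd.
  by congr (A _ x); apply/funext => y; rewrite B3.
- move=> c x /=; rewrite -[RHS](A4 c x); congr (A _ x).
  by apply/funext => y; rewrite B4.
Qed.

Definition periodic v f := forall x, f (x + v) = f x.

Lemma averaging_periodic A v f : averaging A -> bdd f -> periodic v f ->
  periodic v (A f).
Proof.
move=> [_ _ A3 _] bf pf x; rewrite -A3//; congr (A _ x).
by apply/funext => y; rewrite pf.
Qed.

Lemma average_exists v : exists E, [/\ averaging E,
  forall f, bdd f -> periodic v (E f) &
  forall f, periodic v f -> E f = f].
Proof.
have [M [M1 M2 M3 M4]] := mean_exists.
have bs f x : bdd f -> bdd (fun n => f (x + v *+ n)).
  by move=> bf; apply: (@bdd_comp _ _ (fun n => x + v *+ n)).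
exists (fun f x => M (fun n => f (x + v *+ n))); split; first split.
- by move=> a f g bf bg x; apply: M1; apply: bs.
- by move=> f g bf bg fg x; apply: M2 => //; apply: bs.
- by move=> f h bf x; congr M; apply/funext => n; rewrite addrAC.
- by move=> c x; apply: M3.
- move=> f bf x; rewrite -[RHS](M4 _ (bs f x bf)); congr M.
  by apply/funext => n; rewrite mulrS addrA.
- move=> f pf; apply/funext => x; rewrite -[RHS](M3 (f x)); congr M.
  apply/funext; elim=> [|n IH]; first by rewrite mulr0n addr0.
  by rewrite mulrSr addrA pf.
Qed.

Lemma averagingB A f g x : averaging A -> bdd f -> bdd g ->
  A (fun y => f y - g y) x = A f x - A g x.
Proof.
move=> [A1 _ _ _] bf bg; have := A1 (-1) g f bg bf x.
rewrite mulN1r addrC => <-; congr (A _ x).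
by apply/funext => y; rewrite mulN1r addrC.
Qed.

Lemma averagingD A f g x : averaging A -> bdd f -> bdd g ->
  A (fun y => f y + g y) x = A f x + A g x.
Proof.
move=> [A1 _ _ _] bf bg; have := A1 1 f g bf bg x; rewrite mul1r => <-.
by congr (A _ x); apply/funext => y; rewrite mul1r.
Qed.

Lemma averaging_sum A (I : Type) (s : seq I) (F : I -> V -> R) x : averaging A ->
  (forall i, bdd (F i)) -> A (fun y => \sum_(i <- s) F i y) x = \sum_(i <- s) A (F i) x.
Proof.
move=> aA bF; elim: s => [|i s IH].
  rewrite big_nil; have [_ _ _ Ac] := aA; rewrite -[RHS](Ac 0 x).
  by congr (A _ x); apply/funext => y; rewrite big_nil.
rewrite big_cons -IH -averagingD//.
  by congr (A _ x); apply/funext => y; rewrite big_cons.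
elim: s {IH} => [|j s [C HC]].
  by exists 0 => y; rewrite big_nil normr0.
have [D HD] := bF j; exists (D + C) => y; rewrite big_cons.
by rewrite (le_trans (ler_normD _ _))// lerD.
Qed.

(* [w = E_e w + E_t w - E_t E_e w] whenever [w] is annihilated by the product
   of the difference operators of [e] and [t]; hence one of the three terms
   survives each further averaging. *)
Lemma periodic_averages (I : eqType) (s : seq I) (e t : I -> V) f x : bdd f ->
  f x != 0 ->
  (forall i, i \in s -> forall y, f (y + t i + e i) - f (y + t i) = f (y + e i) - f y) ->
  exists A, [/\ averaging A, exists y, A f y != 0 &
    forall i, i \in s -> (forall g, bdd g -> periodic (e i) (A g)) \/
                         (forall g, bdd g -> periodic (t i) (A g))].
Proof.
move=> bf fx; elim: s => [_|i s IH H]; first by exists id; split => //; exists x.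
have [|A [aA [y Ay] HA]] := IH; first by move=> j js; apply: H; rewrite in_cons js orbT.
have [E [aE Ep Eid]] := average_exists (e i).
have [T [aT Tp Tid]] := average_exists (t i).
have bEf := averaging_bdd aE bf; have bTf := averaging_bdd aT bf.
have bTEf := averaging_bdd aT bEf.
have fE z : f z - E f z = T f z - T (E f) z.
  rewrite -averagingB// Tid// => {}z.
  (* By hypothesis [g] is [e i]-periodic, so [E] fixes it; as [E] commutes with translations, this
     says that [f - E f] is [t i]-periodic, hence fixed by [T]. *)
  pose g z := f (z + t i) - f z.
  have bg : bdd g.
    case: bf => C fC; exists (C + C) => a.
    by rewrite (le_trans (ler_normB _ _))// lerD.
  have Eg : E g = g.
    by apply: Eid => a; rewrite /g addrAC; have := H i (mem_head _ _) a; lra.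
  have := congr1 (@^~ z) Eg.
  rewrite /g averagingB//; last exact: (@bdd_comp _ _ (+%R^~ (t i))).
  by case: (aE) => _ _ -> // _; lra.
have [B [aB Bf Bp]] : exists B, [/\ averaging B, A (B f) y != 0 &
    (forall g, bdd g -> periodic (e i) (B g)) \/
    (forall g, bdd g -> periodic (t i) (B g))].
  have AfE : A f y = A (E f) y + (A (T f) y - A (T (E f)) y).
    rewrite -averagingB// -averagingD//.
      by congr (A _ y); apply/funext => z; rewrite -fE addrC subrK.
    by have := bddZD (-1) bTEf bTf; congr bdd; apply/funext => z; rewrite mulN1r addrC.
  have [E0|E0] := eqVneq (A (E f) y) 0; last by exists E; split => //; left.
  have [T0|T0] := eqVneq (A (T f) y) 0; last by exists T; split => //; right.
  exists (T \o E); split; first exact: averaging_comp.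
    by apply: contra Ay => /eqP /= TE0; rewrite AfE E0 T0 TE0 subr0 addr0.
  by right=> g bg; apply/Tp/averaging_bdd.
exists (A \o B); split; first exact: averaging_comp.
  by exists y.
(* The new period of [B g] passes through [A], which commutes with translations; the earlier periods
   are kept because [A] is applied last. *)
move=> j; rewrite in_cons => /orP[/eqP ->|/HA Hj].
  by case: Bp => Bp; [left|right] => g bg; apply: averaging_periodic (Bp g bg) => //;
    apply: averaging_bdd.
by case: Hj => Hj; [left|right] => g bg; apply/Hj/averaging_bdd.
Qed.

End Averages.

(** * Counting translates *)

Section Mass.
Local Open Scope ereal_scope.
Variables (R : realType) (w : R * R -> nat).
Implicit Types (A B C : set (R * R)) (x y l : R * R).

Definition mass A : \bar R := \esum_(l in A) ((w l)%:R : R)%:E.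

(* The total multiplicity of the [l] whose translate [l + A] contains [x]. *)
Definition hits A x : \bar R := mass [set l | A (x - l)%R].

Definition box y (D : R) : set (R * R) :=
  [set l | (`|l.1 - y.1| <= D)%R /\ (`|l.2 - y.2| <= D)%R].

(** Stronger than local finiteness: [C] does not depend on the centre [y]. This uniformity makes the
    counting functions bounded, so that they can be averaged, and it supplies the bound of the
    pigeonhole argument. *)
Definition locally_bounded := forall D, exists C : R, forall y, mass (box y D) <= C%:E.

Lemma mass_ge0 A : 0 <= mass A.
Proof. by apply: esum_ge0 => l _; rewrite lee_fin. Qed.

Lemma mass_disjoint A B : A `&` B = set0 -> mass (A `|` B) = mass A + mass B.
Proof.
move=> AB; rewrite /mass (esumID A); last by move=> l _; rewrite lee_fin.
congr (_ + _); first congr esum.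
  by apply/seteqP; split=> [l []|l Al]//; split=> //; left.
congr esum; apply/seteqP; split=> l; first by move=> [[|]].
by move=> Bl; split; [right|move=> Al; have : (A `&` B) l by []; rewrite AB].
Qed.

Lemma mass_supp A B : (forall l, (0 < w l)%N -> A l <-> B l) -> mass A = mass B.
Proof.
move=> AB; rewrite /mass esum_mkcond [RHS]esum_mkcond; apply: eq_esum => l _.
have [w0|w0] := posnP (w l); first by rewrite w0; case: ifP; case: ifP.
by rewrite (_ : (l \in A) = (l \in B))//; apply/idP/idP; rewrite !inE => /(AB _ w0).
Qed.

Lemma mass_le A B : (forall l, (0 < w l)%N -> A l -> B l) -> mass A <= mass B.
Proof.
move=> AB; rewrite /mass esum_mkcond [leRHS]esum_mkcond; apply: le_esum => l _.
have [w0|w0] := posnP (w l); first by rewrite w0; case: ifP; case: ifP.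
case: ifPn => lA; last by case: ifP => _ //; rewrite lee_fin.
by rewrite ifT//; move: lA; rewrite !inE => /(AB _ w0).
Qed.

Lemma mass0 : mass set0 = 0.
Proof. by rewrite /mass esum_set0. Qed.

Lemma mass1 l : mass [set l] = (w l)%:R%:E.
Proof. by rewrite /mass esum_set1// lee_fin. Qed.

Lemma mass_setU A B : mass (A `|` B) <= mass A + mass B.
Proof.
have -> : A `|` B = A `|` (B `\` A) by rewrite setUDr setDv setD0.
rewrite mass_disjoint ?leeD2l//; first by apply: mass_le => l _ [].
by apply/seteqP; split=> // l [? []].
Qed.

(** Every point of the multi-set weighs at least 1, so more than [C] of them would exceed the
    bound. *)
Lemma mass_finite A (C : R) : mass A <= C%:E ->
  exists s : seq (R * R), forall l, (0 < w l)%N -> A l -> l \in s.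
Proof.
move=> AC; have [/finite_seqP[s sE]|] :=
  pselect (finite_set (A `&` [set l | (0 < w l)%N])).
  by exists s => l wl Al; have : (A `&` [set l | (0 < w l)%N]) l by []; rewrite sE.
pose n := (Num.truncn `|C|).+1.
move=> /infinite_set_fset -/(_ n)[B BA nB]; exfalso.
have : n%:R%:E <= C%:E :> \bar R.
  apply: le_trans AC; apply: esum_ge; exists [set` B]; first by split => // l /BA[].
  rewrite fsbig_finite//= set_fsetK.
  apply: (@le_trans _ _ (\sum_(i <- B) 1%:E)).
    by rewrite sumEFin lee_fin big_const_seq count_predT iter_addr_0 ler_nat.
  rewrite !big_seq; apply: lee_sum => l lB; rewrite lee_fin ler1n.
  by have [] := BA _ lB.
rewrite lee_fin leNgt; apply/negP; rewrite negbK.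
by rewrite (le_lt_trans (ler_norm C))// /n truncnS_gt.
Qed.

Lemma hits_disjoint A B x : A `&` B = set0 -> hits (A `|` B) x = hits A x + hits B x.
Proof.
move=> AB; rewrite /hits -mass_disjoint//; apply/seteqP; split=> // l [a b].
by have : (A `&` B) (x - l)%R by []; rewrite AB.
Qed.

Hypothesis wlb : locally_bounded.

Lemma mass_lt_pinfty A y D : A `<=` box y D -> mass A \is a fin_num.
Proof.
move=> AD; have [C HC] := wlb D; rewrite ge0_fin_numE ?mass_ge0//.
by rewrite (le_lt_trans (mass_le (fun l _ => @AD l)))// (le_lt_trans (HC y))// ltry.
Qed.

Lemma hits_fin A x D : (forall p, A p -> (`|p.1| <= D /\ `|p.2| <= D)%R) ->
  hits A x \is a fin_num.
Proof.
move=> AD; apply: (@mass_lt_pinfty _ x D) => l /AD[h1 h2].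
by split; rewrite distrC; [exact: h1|exact: h2].
Qed.

Lemma hits_supp y A B x : (forall l, (0 < w l)%N -> A (y - l)%R <-> B (x - l)%R) ->
  hits A y = hits B x.
Proof. exact: mass_supp. Qed.

Lemma box_finite y D : exists s : seq (R * R),
  forall l, (0 < w l)%N -> box y D l -> l \in s.
Proof. by have [C HC] := wlb D; exact: mass_finite (HC y). Qed.

Section Polygon.
Variables (hs : seq (R * R * R)) (D : R).
Hypothesis hsD : forall p, halfplanes hs p -> (`|p.1| <= D /\ `|p.2| <= D)%R.
Local Open Scope ring_scope.

Lemma hits_half_near v x : generic hs v ->
  exists2 d, 0 < d & forall s v', 0 < s -> s < d ->
    `|v'.1 - v.1| < d -> `|v'.2 - v.2| < d ->
    hits (halfplanes hs) (x + smul s v') = hits (half hs v) x.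
Proof.
(* The polygon has size [D], and [smul s v'] exceeds [v] by at most 1 in each coordinate. Translates
   outside this box therefore miss both points, and the finitely many inside share a threshold. *)
move=> gv; have [S HS] := box_finite x (D + `|v.1| + `|v.2| + 1).
have [e e0 He] := small_all (fun l _ => half_near (x - l) gv) (s := S).
exists (Num.min e 1); first by rewrite lt_min e0 ltr01.
move=> s v' s0 sd v1 v2; apply: hits_supp => l wl.
have d0 : 0 < Num.min e 1 by rewrite lt_min e0 ltr01.
have de : Num.min e 1 <= e by rewrite ge_min lexx.
have dl : Num.min e 1 <= 1 by rewrite ge_min lexx orbT.
have [/(He _ d0 de)/(_ _ _ s0 sd v1 v2)|lS] := boolP (l \in S).
  by rewrite addrAC.
have a1 := normr_ge0 v.1; have a2 := normr_ge0 v.2.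
have nb p : `|(x - l).1 - p.1| <= `|v.1| + 1 -> `|(x - l).2 - p.2| <= `|v.2| + 1 ->
    ~ halfplanes hs p.
  move=> p1 p2 /hsD[h1 h2]; move/negP: lS; apply; apply: HS => //; split.
    rewrite distrC -(subrK p.1 (x.1 - l.1)).
    by apply: (le_trans (ler_normD _ _)); move: p1 => /= p1; lra.
  rewrite distrC -(subrK p.2 (x.2 - l.2)).
  by apply: (le_trans (ler_normD _ _)); move: p2 => /= p2; lra.
split=> H; exfalso.
  have sv (c c' : R) : `|c' - c| < Num.min e 1 -> `|s * c'| <= `|c| + 1.
    move=> cc; rewrite normrM (gtr0_norm s0) -[leRHS]mul1r.
    apply: ler_pM => //; [exact: ltW|exact: le_trans (ltW sd) dl|].
    rewrite -(subrK c c') addrC (le_trans (ler_normD _ _))// lerD2l.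
    exact: le_trans (ltW cc) dl.
  apply: nb H; rewrite /= -(normrN (_ - _)).
    by rewrite (_ : - _ = s * v'.1) ?sv//; ring.
  by rewrite (_ : - _ = s * v'.2) ?sv//; ring.
by apply: nb (half_halfplanes H); rewrite subrr normr0; lra.
Qed.

Lemma hits_half_step v x : generic hs v ->
  exists2 d, 0 < d & forall s, 0 < s -> s < d ->
    hits (half hs v) (x + smul s v) = hits (half hs v) x.
Proof.
move=> gv; have [S HS] := box_finite x (D + `|v.1| + `|v.2|).
have [e e0 He] := small_all (fun l _ => half_step (x - l) gv) (s := S).
exists (Num.min e 1); first by rewrite lt_min e0 ltr01.
move=> s s0 sd; apply: hits_supp => l wl.
have de : s <= e by rewrite (le_trans (ltW sd))// ge_min lexx.
have dl : s <= 1 by rewrite (le_trans (ltW sd))// ge_min lexx orbT.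
have [/(He _ s0 de)|lS] := boolP (l \in S); first by rewrite addrAC.
have a1 := normr_ge0 v.1; have a2 := normr_ge0 v.2.
have nb p : `|(x - l).1 - p.1| <= `|v.1| -> `|(x - l).2 - p.2| <= `|v.2| ->
    ~ halfplanes hs p.
  move=> p1 p2 /hsD[h1 h2]; move/negP: lS; apply; apply: HS => //; split.
    rewrite distrC -(subrK p.1 (x.1 - l.1)).
    by apply: (le_trans (ler_normD _ _)); move: p1 => /= p1; lra.
  rewrite distrC -(subrK p.2 (x.2 - l.2)).
  by apply: (le_trans (ler_normD _ _)); move: p2 => /= p2; lra.
have sv (c : R) : `|s * c| <= `|c|.
  by rewrite normrM (gtr0_norm s0) ler_piMl.
split=> /half_halfplanes H; exfalso; apply: nb H; rewrite ?subrr ?normr0//=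
  -(normrN (_ - _)).
  by rewrite (_ : - _ = s * v.1) ?sv//; ring.
by rewrite (_ : - _ = s * v.2) ?sv//; ring.
Qed.

Lemma hits_turn u z x :
  (forall h, h \in hs -> dot h.1 u = 0 -> dot h.1 z != 0) ->
  exists2 e, 0 < e & forall d, 0 < d -> d <= e -> generic hs (u + smul d z) /\
    (hits (weak hs u) x = hits (half hs (u + smul d z)%R) x + hits (face hs z u) x)%E.
Proof.
move=> /half_turn[e e0 He]; exists e => // d d0 de; have [gd Hd] := He d d0 de.
split=> //; rewrite -hits_disjoint.
  congr (hits _ x); apply/seteqP; split=> p.
    by move=> W; have [T|T] := pselect (tight hs z u p); [right|left; apply/Hd].
  by move=> [/Hd[]|[]].
by apply/seteqP; split=> // p [/Hd[_ +] [_]].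
Qed.

End Polygon.
End Mass.

(** * From almost everywhere to everywhere *)

Section Tiling.
Variables (R : realType).
Implicit Types (w : R * R -> nat) (A P : set (R * R)) (x y l : R * R).
Local Notation mu2 := (@lebesgue_measure R \x @lebesgue_measure R)%E.

Lemma ae_box (Q : R * R -> Prop) (c : R * R) (d : R) : 0 < d ->
  {ae mu2, forall x, Q x} ->
  exists x, [/\ `|x.1 - c.1| < d, `|x.2 - c.2| < d & Q x].
Proof.
move=> d0 [N [mN N0 QN]]; apply: contrapT => H.
pose I1 := `]c.1 - d, c.1 + d[%classic; pose I2 := `]c.2 - d, c.2 + d[%classic.
have IN : I1 `*` I2 `<=` N.
  move=> x [x1 x2]; apply: QN => Qx; apply: H; exists x; split => //.
    by move: x1; rewrite /I1 /= in_itv /= ltr_norml => /andP[a b]; apply/andP; split; lra.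
  by move: x2; rewrite /I2 /= in_itv /= ltr_norml => /andP[a b]; apply/andP; split; lra.
have mI : measurable (I1 `*` I2) by apply: measurableX; exact: measurable_itv.
have : (mu2 (I1 `*` I2) <= 0)%E.
  by rewrite -N0; apply: le_measure => //; rewrite inE.
rewrite product_measure1E; [|exact: measurable_itv|exact: measurable_itv].
have lI (a : R) : lebesgue_measure (`]a - d, a + d[%classic : set R) = (2 * d)%:E.
  by rewrite lebesgue_measure_itv /= lte_fin ifT; [rewrite -EFinB; congr EFin; ring|lra].
rewrite -[(_ * _)%E]/(lebesgue_measure I1 * lebesgue_measure I2)%E /I1 /I2 !lI.
by rewrite -EFinM lee_fin leNgt mulr_gt0//; lra.
Qed.

Lemma multi_tiles_hits k P w : multi_tiles_of_multiplicity k P w <->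
  {ae mu2, forall x, hits w P x = (k%:R : R)%:E}.
Proof.
rewrite /multi_tiles_of_multiplicity.
suff E x : (\esum_(l in multiset_support w) ((w l)%:R * \1_P (x - l) : R)%:E =
    hits w P x)%E.
  by split=> -[N [mN N0 QN]]; exists N; split=> // x /= Hx; apply: QN => /=;
    [rewrite E|rewrite -E].
rewrite /hits /mass esum_mkcond [RHS]esum_mkcond; apply: eq_esum => l _.
rewrite indicE; have [w0|w0] := posnP (w l).
  by rewrite w0 mul0r; case: ifP; case: ifP.
rewrite ifT; last by rewrite inE.
by have [|] := pselect (P (x - l)) => Pl; [rewrite !mem_set// mulr1|rewrite !memNset// mulr0].
Qed.

Lemma mass_box_double w (D C : R) : (forall y, mass w (box y D) <= C%:E)%E ->
  forall y, (mass w (box y (2 * D)) <= (4 * C)%:E)%E.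
Proof.
move=> H y.
have sub : box y (2 * D) `<=` (box (y + (D, D)) D `|` box (y + (D, - D)) D) `|`
    (box (y + (- D, D)) D `|` box (y + (- D, - D)) D).
  move=> l [] /=; rewrite /box /setU /= !ler_norml => /andP[a1 a2] /andP[b1 b2].
  have [h|h] := leP l.1 y.1; have [h'|h'] := leP l.2 y.2;
    [right; right|right; left|left; right|left; left];
    by split; rewrite ?ler_norml; apply/andP; split; lra.
apply: (le_trans (mass_le (fun l _ => @sub l))).
apply: (le_trans (mass_setU _ _ _)).
have two A B : (mass w A <= C%:E -> mass w B <= C%:E ->
    mass w (A `|` B) <= (C + C)%:E)%E.
  by move=> a b; apply: (le_trans (mass_setU _ _ _)); rewrite EFinD leeD.
have -> : 4 * C = (C + C) + (C + C) by ring.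
by rewrite EFinD leeD//; apply: two.
Qed.

Lemma small_boxes_locally_bounded w (r C : R) : 0 < r ->
  (forall y, mass w (box y r) <= C%:E)%E -> locally_bounded w.
Proof.
move=> r0 H D.
have [n nD] : exists n, D <= 2 ^+ n * r.
  exists (Num.bound `|D / r|); rewrite -ler_pdivrMr//.
  apply: (le_trans (ler_norm _)); apply: (le_trans (ltW (archi_boundP _))) => //.
  by rewrite -natrX ler_nat; apply/ltnW/ltn_expl.
have {H} : forall y, (mass w (box y (2 ^+ n * r)) <= (4 ^+ n * C)%:E)%E.
  elim: n {nD} => [|n IH] y; first by rewrite !expr0 !mul1r.
  by rewrite !exprS -!mulrA; apply: mass_box_double.
move=> H; exists (4 ^+ n * C) => y; apply: le_trans (H y).
by apply: mass_le => l _ [a b]; split; apply: le_trans nD.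
Qed.

(** A point [x] of count [k] exists within [r / 2] of [y + q]. If [l] is within [r / 4] of [y], then
    [x - l] is within [r] of [q], so the translate of [P] by [l] covers [x]: such [l] have total
    multiplicity at most [k]. *)
Lemma tiling_locally_bounded k P w q (r : R) : 0 < r ->
  (forall p, `|p.1 - q.1| < r -> `|p.2 - q.2| < r -> P p) ->
  {ae mu2, forall x, hits w P x = (k%:R : R)%:E} -> locally_bounded w.
Proof.
move=> r0 Pq T; apply: (@small_boxes_locally_bounded w (r / 4) k%:R) => [|y]; first lra.
have r20 : 0 < r / 2 by lra.
have [x [x1 x2 <-]] := ae_box (y + q) r20 T.
apply: mass_le => l _ [l1 l2] /=; move: x1 x2 => /= x1 x2.
have aux (a b c d : R) : `|a - (c + d)| < r / 2 -> `|b - c| <= r / 4 ->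
    `|a - b - d| < r.
  rewrite !ltr_norml ler_norml => /andP[? ?] /andP[? ?]; apply/andP; split; lra.
by apply: Pq => /=; [apply: aux x1 l1|apply: aux x2 l2].
Qed.

Section Polygon.
Variables (w : R * R -> nat) (hs : seq (R * R * R)) (D : R) (k : nat).
Hypothesis wlb : locally_bounded w.
Hypothesis hsD : forall p, halfplanes hs p -> `|p.1| <= D /\ `|p.2| <= D.

(** For a fixed small [s], the points [x + smul s v'] with [v'] close to [v] form a box of positive
    measure, so one of them has count [k]. *)
Lemma tiling_half v x : {ae mu2, forall x, hits w (halfplanes hs) x = (k%:R : R)%:E} ->
  generic hs v -> hits w (half hs v) x = (k%:R : R)%:E.
Proof.
move=> T gv; have [d d0 Hd] := hits_half_near wlb hsD x gv.
pose s := d / 2; have s0 : 0 < s by rewrite /s; lra.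
have sd : 0 < s * d by rewrite mulr_gt0.
have [y [y1 y2 <-]] := ae_box (x + smul s v) sd T.
pose v' : R * R := smul s^-1 (y - x).
have yE : y = x + smul s v'.
  by rewrite /v' -smulA divff ?gt_eqF//; apply: pairP => /=; ring.
have aux (a b c : R) : `|a - (b + s * c)| < s * d -> `|s^-1 * (a - b) - c| < d.
  have -> : a - (b + s * c) = s * (s^-1 * (a - b) - c) by field; rewrite gt_eqF.
  by rewrite normrM (gtr0_norm s0) ltr_pM2l.
by rewrite yE Hd//; [rewrite /s; lra|apply: aux|apply: aux].
Qed.

Lemma half_fin u x : hits w (half hs u) x \is a fin_num.
Proof. by apply: (@hits_fin _ _ wlb _ _ D) => p /half_halfplanes /hsD. Qed.

Lemma face_fin n u x : hits w (face hs n u) x \is a fin_num.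
Proof. by apply: (@hits_fin _ _ wlb _ _ D) => p [/weak_halfplanes /hsD]. Qed.

(** Turning from [u] towards [z] or towards [- z] removes one face or the other from the same set
    [weak hs u], and what is left has count [k] in both cases. *)
Lemma tiling_face u z x : {ae mu2, forall x, hits w (halfplanes hs) x = (k%:R : R)%:E} ->
  (forall h, h \in hs -> dot h.1 u = 0 -> dot h.1 z != 0) ->
  hits w (face hs z u) x = hits w (face hs (- z) u) x.
Proof.
move=> T uz; have [e e0 He] := hits_turn w x uz.
have [|e' e'0 He'] := @hits_turn _ w hs u (- z) x.
  by move=> h hhs hu; rewrite dotNr oppr_eq0 uz.
have [g E] := He e e0 (lexx _); have [g' E'] := He' e' e'0 (lexx _).
move: E; rewrite E' !tiling_half// => /eqP; rewrite eq_sym => /eqP.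
by rewrite -(fineK (face_fin z u x)) -(fineK (face_fin (- z) u x)) -!EFinD => -[/addrI ->].
Qed.

End Polygon.
End Tiling.

(** * Opposite edges *)

Section Segment.
Variables (R : realType).
Implicit Types (w : R * R -> nat) (A : set (R * R)) (u n e x l t : R * R).

Definition seg u (r : R) : set (R * R) :=
  [set p | exists s, [/\ 0 <= s, s < r & p = smul s u]].

(** A segment alone may contain no point to count. Thickened along [rot u], a large enough one
    always does, while inequalities between segment counts still sum up to inequalities between
    strips. *)
Definition strip u (r h : R) : set (R * R) :=
  [set p | exists s y, [/\ 0 <= s, s < r, 0 <= y, y < h &
    p = smul s u + smul y (rot u)]].

Lemma hits_pos w A x : (0 < hits w A x)%E -> exists2 l, (0 < w l)%N & A (x - l).
Proof.
move=> H; apply: contrapT => ne; move: H.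
suff -> : hits w A x = 0%E by rewrite ltxx.
rewrite -(mass0 w); apply: mass_supp => l wl; split=> // Al.
by case: ne; exists l.
Qed.

Lemma hits_le w A B x : (forall p, A p -> B p) -> (hits w A x <= hits w B x)%E.
Proof. by move=> AB; apply: mass_le => l _; apply: AB. Qed.

Lemma hits_shift w A x t : hits w [set p | A (p - t)] x = hits w A (x - t).
Proof. by congr (mass w _); apply/seteqP; split=> l /=; rewrite addrAC. Qed.

Lemma smul0 u : smul 0 u = 0.
Proof. by apply: pairP => /=; rewrite mul0r. Qed.

Lemma rot_basis u p : u != 0 ->
  p = smul (dot u p / dot u u) u + smul (dot (rot u) p / dot u u) (rot u).
Proof.
move=> /dotnn_gt0; rewrite lt_neqAle eq_sym => /andP[u0 _].
move: u0; rewrite /dot /rot /= => u0.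
by apply: pairP => /=; field.
Qed.

Lemma rot_coord u (s y : R) : u != 0 ->
  dot u (smul s u + smul y (rot u)) / dot u u = s /\
  dot (rot u) (smul s u + smul y (rot u)) / dot u u = y.
Proof.
move=> /dotnn_gt0; rewrite lt_neqAle eq_sym => /andP[u0 _].
by move: u0; rewrite /dot /rot /= => u0; split; field.
Qed.

Lemma rot_coord_inj u (s y s' y' : R) : u != 0 ->
  smul s u + smul y (rot u) = smul s' u + smul y' (rot u) -> s = s' /\ y = y'.
Proof.
move=> u0 E; have [h1 h2] := rot_coord s y u0; have [h3 h4] := rot_coord s' y' u0.
by rewrite -h1 -{2}h2 -h3 -{2}h4 E.
Qed.

(** Fubini for sums of non-negative terms: the coordinate along [rot u] tells on which segment a
    point of the strip lies. *)
Lemma hits_strip w u (r h : R) x : u != 0 ->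
  hits w (strip u r h) x =
  \esum_(y in [set y | 0 <= y < h]) hits w (seg u r) (x - smul y (rot u)).
Proof.
move=> u0; rewrite /hits /mass esum_esum; last by move=> i j _ _; rewrite lee_fin.
apply: (reindex_esum _ _ snd); split.
- move=> [y l] [/= /andP[y0 yh] [s [s0 sr E]]].
  by exists s, y; split => //=; rewrite -E /= addrAC subrK.
- move=> [y l] [y' l']; rewrite !inE => -[_ [s [_ _ E]]] [_ [s' [_ _ E']]] /= ll.
  rewrite -ll in E' *; congr pair.
  have : smul s u + smul y (rot u) = smul s' u + smul y' (rot u).
    by rewrite -E -E' /= addrAC subrK [RHS]addrAC subrK.
  by move=> /(rot_coord_inj u0)[].
- move=> l [s [y [s0 sr y0 yh E]]]; exists (y, l) => //.
  split=> /=; first by rewrite y0.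
  by exists s; split=> //=; rewrite addrAC E addrK.
Qed.

Lemma strip_split w u (d h : R) K x : u != 0 -> 0 <= d ->
  hits w (strip u (K%:R * d) h) x =
  (\sum_(j < K) hits w (strip u d h) (x - smul (j%:R * d) u)%R)%E.
Proof.
move=> u0 d0; elim: K => [|K IH].
  rewrite big_ord0 -(mass0 w); apply: mass_supp => l _; split=> // -[s [y [s0]]].
  by rewrite mul0r ltNge s0.
rewrite big_ord_recr /= -IH -hits_shift -hits_disjoint.
  congr (hits w _ x); apply/seteqP; split=> p.
    move=> [s [y [s0 sr y0 yh pE]]]; have [sK|sK] := ltP s (K%:R * d).
      by left; exists s, y.
    right; exists (s - K%:R * d), y; split => //; first lra.
      by move: sr; rewrite -natr1 mulrDl mul1r; lra.
    by rewrite pE; apply: pairP => /=; ring.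
  have Kd : 0 <= K%:R * d by rewrite mulr_ge0.
  rewrite -natr1 mulrDl mul1r.
  move=> [[s [y [s0 sr y0 yh pE]]]|[s [y [s0 sr y0 yh pE]]]].
    by exists s, y; split => //; lra.
  exists (s + K%:R * d), y; split => //; [lra|lra|].
  by rewrite -(subrK (smul (K%:R * d) u) p) pE; apply: pairP => /=; ring.
apply/seteqP; split => // p [[s [y [s0 sr _ _ pE]]] [s' [y' [s0' _ _ _ /= pE']]]].
have : smul s u + smul y (rot u) = smul (s' + K%:R * d) u + smul y' (rot u).
  by rewrite -pE -(subrK (smul (K%:R * d) u) p) pE'; apply: pairP => /=; ring.
by move=> /(rot_coord_inj u0)[sE _]; clear - sr sE s0'; lra.
Qed.

(** [c] bounds the coordinates, in the basis [u], [rot u], of the vectors of a box of size [rho]. A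
    point of the multi-set near the [z] for which [x - z] is the centre of the strip therefore gives
    a hit. *)
Lemma strip_hits_pos w u (r h rho : R) : u != 0 ->
  (forall x, exists2 l, (0 < w l)%N & box x rho l) ->
  let c := rho * (`|u.1| + `|u.2|) / dot u u in 2 * c < r -> 2 * c < h ->
  forall x, (1 <= hits w (strip u r h) x)%E.
Proof.
move=> u0 dense c cr ch x; have uu := dotnn_gt0 u0.
pose z := x - smul (r / 2) u - smul (h / 2) (rot u).
have [l wl [l1 l2]] := dense z.
apply: (@le_trans _ _ (mass w [set l])); first by rewrite mass1 lee_fin ler1n.
apply: mass_le => _ _ ->; pose q := z - l.
have qE := rot_basis q u0; set a := dot u q / _ in qE; set b := dot (rot u) q / _ in qE.
have bound v : `|v.1| + `|v.2| = `|u.1| + `|u.2| -> `|dot v q / dot u u| <= c.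
  move=> E; rewrite normrM normfV (gtr0_norm uu) /c -E ler_pM2r ?invr_gt0//.
  rewrite /dot; apply: (le_trans (ler_normD _ _)); rewrite !normrM mulrDr.
  by rewrite /q /= (mulrC rho) (mulrC rho) lerD// ler_wpM2l// distrC.
have : `|a| <= c by apply: bound.
have : `|b| <= c by apply: bound; rewrite /= normrN addrC.
rewrite !ler_norml => /andP[b1 b2] /andP[a1 a2].
exists (r / 2 + a), (h / 2 + b); split; [clear qE; lra|clear qE; lra|clear qE; lra|clear qE; lra|].
have -> : x - l = q + smul (r / 2) u + smul (h / 2) (rot u).
  by rewrite /q /z; apply: pairP => /=; ring.
by rewrite {1}qE; apply: pairP => /=; ring.
Qed.

Lemma strip_bounded w u (r h : R) : locally_bounded w ->
  exists C : R, forall x, (hits w (strip u r h) x <= C%:E)%E.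
Proof.
move=> wlb; have [C HC] := wlb (r * (`|u.1| + `|u.2|) + h * (`|u.1| + `|u.2|)).
exists C => x; apply: le_trans (HC x); apply: mass_le => l _ [s [y [s0 sr y0 yh E]]].
have aux (a b c d : R) : `|a| <= c + d -> `|b| <= c + d ->
    `|s * a + y * b| <= r * (c + d) + h * (c + d).
  move=> ac bd; apply: (le_trans (ler_normD _ _)); rewrite !normrM.
  by rewrite (ger0_norm s0) (ger0_norm y0) lerD// ler_pM// ltW.
split; rewrite distrC.
  have -> : x.1 - l.1 = s * u.1 + y * - u.2 by have := congr1 fst E.
  by apply: aux; rewrite ?normrN ?lerDl ?lerDr.
have -> : x.2 - l.2 = s * u.2 + y * u.1 by have := congr1 snd E.
by apply: aux; rewrite ?lerDl ?lerDr.
Qed.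

(* Cutting the longer segment into [K] equal pieces, at least one more than
   the shorter one needs, the density of the strips of the pieces would grow
   by a fixed amount along the multiples of [- t]. *)
Lemma seg_length_le w u t (r1 r2 rho : R) : u != 0 -> 0 <= r2 ->
  locally_bounded w -> (forall x, exists2 l, (0 < w l)%N & box x rho l) ->
  (forall x, hits w (seg u r1) x <= hits w (seg u r2) (x - t)%R)%E -> r1 <= r2.
Proof.
move=> u0 r20 wlb dense H; rewrite leNgt; apply/negP => r21.
have r10 : 0 < r1 by lra.
(* Large enough for [K - 1] pieces of length [r1 / K] to cover the length [r2]. *)
pose K := Num.bound (r1 / (r1 - r2)).
have Kr : r1 / (r1 - r2) < K%:R by apply: archi_boundP; rewrite divr_ge0//; lra.
have K0 : 0 < K%:R :> R by apply: le_lt_trans Kr; rewrite divr_ge0//; lra.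
pose d := r1 / K%:R; have d0 : 0 < d by rewrite divr_gt0.
have Kd : K%:R * d = r1 by rewrite mulrC divfK ?gt_eqF.
have Kd2 : r2 <= K.-1%:R * d.
  have : d * K%:R < (r1 - r2) * K%:R.
    by rewrite divfK ?gt_eqF// mulrC -ltr_pdivrMr//; lra.
  rewrite ltr_pM2r// => dr; rewrite -subn1 natrB ?mulrBl ?Kd ?mul1r; first lra.
  by rewrite -(ltr_nat R).
pose c := rho * (`|u.1| + `|u.2|) / dot u u.
(* With this height, [M] consecutive pieces always contain a point of the multi-set, so the average
   of [g] is at least [1 / M]. *)
pose h := 2 * `|c| + 1; have hc : 2 * c < h by rewrite /h; have := ler_norm c; lra.
pose M := Num.bound (h / d).
have h0 : 0 < h by rewrite /h; have := normr_ge0 c; lra.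
have Mh : h < M%:R * d.
  by rewrite -ltr_pdivrMr//; apply: archi_boundP; rewrite divr_ge0// ltW.
have [C HC] := strip_bounded u d h wlb.
pose g x := fine (hits w (strip u d h) x).
have gE x : hits w (strip u d h) x = (g x)%:E.
  rewrite /g fineK// ge0_fin_numE ?mass_ge0//.
  by rewrite (le_lt_trans (HC x))// ltry.
have g0 x : 0 <= g x by rewrite -lee_fin -gE mass_ge0.
have bg : bdd g.
  by exists C => x; rewrite ger0_norm// -lee_fin -gE.
have splitE N x : hits w (strip u (N%:R * d) h) x = (\sum_(j < N) g (x - smul (j%:R * d) u))%:E.
  by rewrite strip_split ?ltW// -sumEFin; apply: eq_bigr => j _.
have gM x : 1 <= \sum_(j < M) g (x - smul (j%:R * d) u).
  rewrite -lee_fin -splitE; apply: strip_hits_pos => //; exact: lt_trans Mh.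
have gK x : \sum_(j < K) g (x - smul (j%:R * d) u) <=
    \sum_(j < K.-1) g (x - t - smul (j%:R * d) u).
  rewrite -lee_fin -!splitE Kd.
  apply: (@le_trans _ _ (hits w (strip u r2 h) (x - t))).
    rewrite !hits_strip//; apply: le_esum => y _.
    by apply: (le_trans (H _)); rewrite addrAC.
  apply: hits_le => p [s [y [s0 sr y0 yh pE]]]; exists s, y; split => //.
  exact: lt_le_trans sr Kd2.
(* Averaging along [smul d u] makes consecutive pieces indistinguishable: a sum over [N] of them
   becomes [N] times [E g]. *)
have [E [aE pE _]] := average_exists R (smul d u).
have bshift v : bdd (fun x => g (x + v)) by apply: (@bdd_comp _ _ _ (+%R^~ v)).
have EgE N y x : E (fun x => \sum_(j < N) g (x + y - smul (j%:R * d) u)) x = N%:R * E g (x + y).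
  under [X in E X]funext => z do under eq_bigr => j _ do rewrite -addrA.
  rewrite (@averaging_sum _ _ E _ _ (fun (j : 'I_N) z => g (z + (y - smul (j%:R * d) u))))//.
  case: (aE) => _ _ shE _; rewrite (eq_bigr (fun=> E g (x + y))).
    by rewrite sumr_const card_ord mulr_natl.
  move=> j _; rewrite shE// addrA; elim: (j : nat) => [|i IH].
    by rewrite mul0r smul0 subr0.
  rewrite -IH -[LHS]pE//; congr (E g _).
  by rewrite -natr1; apply: pairP => /=; ring.
case: (aE) => _ Ele _ Ec.
have bsum N y : bdd (fun x => \sum_(j < N) g (x + y - smul (j%:R * d) u)).
  exists (N%:R * C) => x; rewrite (le_trans (ler_norm_sum _ _ _))//.
  rewrite (le_trans (y := \sum_(j < N) C))//.
    by apply: ler_sum => j _; rewrite ger0_norm// -lee_fin -gE.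
  by rewrite sumr_const card_ord mulr_natl.
have M0 : 0 < M%:R :> R by rewrite -(pmulr_lgt0 _ d0); apply: lt_trans Mh.
have EM x : M%:R^-1 <= E g x.
  rewrite -[leLHS]mul1r ler_pdivrMr// mulrC -[x in E g x]addr0 -EgE -[leLHS](Ec 1 x).
  by apply: Ele => //; exact: bdd_cst.
have EK x : K%:R * E g x <= K.-1%:R * E g (x - t).
  rewrite -[x in E g x]addr0 -!EgE; apply: Ele => // y; rewrite addr0; exact: gK.
(* With [a = E g x] and [b = E g (x - t)], the inequality [K a <= (K - 1) b] gives
   [a <= (K - 1) (b - a)]; since [a] is at least [1 / M], the gain [b - a] is at least
   [1 / (M K)]. *)
have grow x : E g x + (M%:R * K%:R)^-1 <= E g (x - t).
  have := EK x; have := EM x; rewrite invfM.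
  have KE : K%:R = K.-1%:R + 1 :> R by rewrite natr1 prednK// -(ltr_nat R).
  have m0 : 0 < M%:R^-1 :> R by rewrite invr_gt0.
  have i0 : 0 < K%:R^-1 :> R by rewrite invr_gt0.
  have iK : K%:R * K%:R^-1 = 1 :> R by rewrite divff// gt_eqF.
  have K1 : 0 <= K.-1%:R :> R by [].
  rewrite KE in iK i0 *; move: (E g x) (E g (x - t)) (M%:R^-1) (K.-1%:R) ((K.-1%:R + 1)^-1) m0 i0 iK K1.
  move=> a b m k i m0 i0 ik k0 ma ab.
  have kab : a <= k * (b - a) by lra.
  have ba : 0 < b - a.
    by rewrite ltNge; apply/negP => ba; have := mulr_ge0_le0 k0 ba; lra.
  have : m * i <= (b - a) * ((k + 1) * i).
    by rewrite mulrA ler_pM2r// mulrDr mulr1 mulrC; lra.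
  by rewrite ik; lra.
have growN N x : E g x + N%:R * (M%:R * K%:R)^-1 <= E g (x - t *+ N).
  elim: N x => [|N IH] x; first by rewrite mul0r addr0 mulr0n subr0.
  rewrite -natr1 mulrDl mul1r addrA (mulrSr t) opprD addrA.
  by apply: le_trans (grow _); rewrite lerD2r.
have [B HB] := averaging_bdd aE bg.
pose N := Num.bound (2 * B * (M%:R * K%:R)).
have MK : 0 < M%:R * K%:R :> R by rewrite mulr_gt0.
have B0 : 0 <= B by apply: le_trans (HB 0).
have : 2 * B * (M%:R * K%:R) < N%:R.
  by apply: archi_boundP; apply: mulr_ge0; [apply: mulr_ge0|exact: ltW].
rewrite -ltr_pdivlMr// => NB.
have := growN N 0; have := HB 0; have := HB (0 - t *+ N).
rewrite !ler_norml => /andP[_ b1] /andP[b2 _] b3.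
have : 0 < (M%:R)^-1 :> R by rewrite invr_gt0.
by have := EM 0; lra.
Qed.
End Segment.

(** * Pairs of opposite edges of a tiling polygon *)

Section Edge.
Variables (R : realType).
Implicit Types (w : R * R -> nat) (A : set (R * R)) (u n e x l t : R * R)
  (hs : seq (R * R * R)).
Local Notation mu2 := (@lebesgue_measure R \x @lebesgue_measure R)%E.

Definition seg1 e : set (R * R) :=
  [set p | exists s, [/\ 0 <= s, s < 1 & p = smul s e]].

Definition segr e : set (R * R) :=
  [set p | exists s, [/\ 0 < s, s <= 1 & p = smul s e]].

(** Both half-open versions are recorded, because subtracting them isolates the end points. The
    condition [0 < dot n t] later guarantees that [t] is not parallel to [e]. *)
Definition edge hs n (e t : R * R) := exists a c,
  [/\ 0 < c /\ e = smul c (rot n), 0 < dot n t,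
      face hs n (rot n) = [set p | seg1 e (p - (a + t))] /\
      face hs (- n) (rot n) = [set p | seg1 e (p - a)] &
      face hs n (- rot n) = [set p | segr e (p - (a + t))] /\
      face hs (- n) (- rot n) = [set p | segr e (p - a)]].

Definition no_edge hs n := [/\ face hs n (rot n) = set0, face hs (- n) (rot n) = set0,
  face hs n (- rot n) = set0 & face hs (- n) (- rot n) = set0].

Lemma tight_gt hs n u p q : n != 0 -> u != 0 -> dot n u = 0 ->
  (forall h, h \in hs -> dot h.1 q < h.2) -> tight hs n u p -> dot n q < dot n p.
Proof.
move=> n0 u0 nu Hq [h [hhs hu hn hp]].
have := Hq _ hhs; rewrite -hp.
have -> : h.1 = smul (dot n h.1 / dot n n) n.
  by apply: (@dot0_smul _ u) => //; rewrite dotC.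
by rewrite !dotZl ltr_pM2l// divr_gt0 ?dotnn_gt0// dotC.
Qed.

(** Opposite faces have equal counts by [tiling_face], and [seg_length_le] applied in both
    directions turns this into equal lengths. A common length 0 means that all four faces are
    empty. *)
Lemma tiling_edge hs w k (D : R) q n : n != 0 -> locally_bounded w -> (0 < k)%N ->
  {ae mu2, forall x, hits w (halfplanes hs) x = (k%:R : R)%:E} ->
  (forall h, h \in hs -> h.1 != 0) ->
  (forall h, h \in hs -> dot h.1 q < h.2) ->
  (forall p, halfplanes hs p -> `|p.1| <= D /\ `|p.2| <= D) ->
  no_edge hs n \/ exists e t, edge hs n e t.
Proof.
move=> n0 wlb k0 T hs0 Hq hsD; pose u := rot n.
have u0 : u != 0 by apply: rot_neq0.
have nu : dot n u = 0 by apply: dot_rot.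
have nn0 : - n != 0 by rewrite oppr_eq0.
have nnu : dot (- n) u = 0 by rewrite dotNl nu oppr0.
have [a1 [l1 [l10 F1 F1r]]] := face_segment n0 u0 nu hsD.
have [a2 [l2 [l20 F2 F2r]]] := face_segment nn0 u0 nnu hsD.
(* Some point within 1 of [x] has count [k > 0], so it is covered by a translate, whose vector is
   within [D] of it. *)
have dense x : exists2 l, (0 < w l)%N & box x (D + 1) l.
  have [y [y1 y2 yk]] := ae_box x ltr01 T.
  have [|l wl /hsD[/= h1 h2]] := @hits_pos _ w (halfplanes hs) y.
    by rewrite yk lte_fin ltr0n.
  exists l => //; have aux (a b c : R) : `|a - b| < 1 -> `|a - c| <= D -> `|c - b| <= D + 1.
    by rewrite ltr_norml !ler_norml => /andP[? ?] /andP[? ?]; apply/andP; split; lra.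
  by split; [apply: aux y1 h1|apply: aux y2 h2].
have orth h : h \in hs -> dot h.1 u = 0 -> dot h.1 n != 0.
  move=> hhs hu; apply/negP => /eqP hn.
  have := @dot0_smul _ u n h.1 u0 n0 _ _; rewrite !(dotC u) (dotC n h.1) hn mul0r.
  by move=> /(_ nu hu) h0; have := hs0 _ hhs; rewrite h0 smul0 eqxx.
have FF := tiling_face wlb hsD _ T orth.
have shift1 x : hits w (face hs n u) x = hits w (seg u l1) (x - a1).
  rewrite -hits_shift; congr (hits w _ x); apply/seteqP; split=> p.
    by move=> /F1[s [s0 s1 ->]]; exists s; split=> //; rewrite addrC addKr.
  by move=> [s [s0 s1 pE]]; apply/F1; exists s; split=> //; rewrite -pE addrC subrK.
have shift2 x : hits w (face hs (- n) u) x = hits w (seg u l2) (x - a2).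
  rewrite -hits_shift; congr (hits w _ x); apply/seteqP; split=> p.
    by move=> /F2[s [s0 s1 ->]]; exists s; split=> //; rewrite addrC addKr.
  by move=> [s [s0 s1 pE]]; apply/F2; exists s; split=> //; rewrite -pE addrC subrK.
have l12 : l1 <= l2.
  apply: (@seg_length_le _ w u (a2 - a1) _ _ (D + 1)) => // x.
  have := FF (x + a1); rewrite shift1 shift2 addrK => ->.
  by rewrite opprB addrA.
have l21 : l2 <= l1.
  apply: (@seg_length_le _ w u (a1 - a2) _ _ (D + 1)) => // x.
  have := FF (x + a2); rewrite shift1 shift2 addrK => <-.
  by rewrite opprB addrA.
have {l12 l21} ll : l1 = l2 by apply/eqP; rewrite eq_le l12.
rewrite -{l2 l20}ll in F2 F2r shift2.
move: l10; rewrite le_eqVlt => /orP[/eqP l0|l0]; [left|right].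
  rewrite -l0 in F1 F2 F1r F2r.
  have nil1 (s : R) (p a : R * R) : ~ [/\ 0 <= s, s < 0 & p = a + smul s u].
    by case=> s1 s2 _; move: (le_lt_trans s1 s2); rewrite ltxx.
  have nil2 (s : R) (p a : R * R) : ~ [/\ 0 < s, s <= 0 & p = a + smul s u].
    by case=> s1 s2 _; move: (lt_le_trans s1 s2); rewrite ltxx.
  split; apply/seteqP; split => // p.
  - by move=> /F1[s /nil1].
  - by move=> /F2[s /nil1].
  - by move=> /F1r[s /nil2].
  - by move=> /F2r[s /nil2].
have l0' : l1 != 0 by rewrite gt_eqF.
have sE (s : R) : smul s u = smul (s / l1) (smul l1 u) by rewrite -smulA divfK.
exists (smul l1 u), (a1 - a2), a2, l1.
have aE : a2 + (a1 - a2) = a1 by rewrite addrC subrK.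
split; rewrite ?aE.
- by split.
- have A1 : face hs n u a1 by apply/F1; exists 0; rewrite smul0 addr0.
  have A2 : face hs (- n) u a2 by apply/F2; exists 0; rewrite smul0 addr0.
  have := tight_gt n0 u0 nu Hq A1.2; have := tight_gt nn0 u0 nnu Hq A2.2.
  by rewrite dotBr !dotNl; lra.
- split; apply/seteqP; split=> p.
  + move=> /F1[s [s0 s1 ->]]; exists (s / l1).
    by rewrite -sE [a1 + _]addrC addrK divr_ge0 ?(ltW l0)// ltr_pdivrMr// mul1r.
  + move=> [s [s0 s1 pE]]; apply/F1; exists (s * l1).
    by rewrite smulA -pE addrC subrK mulr_ge0 ?(ltW l0)// gtr_pMl.
  + move=> /F2[s [s0 s1 ->]]; exists (s / l1).
    by rewrite -sE [a2 + _]addrC addrK divr_ge0 ?(ltW l0)// ltr_pdivrMr// mul1r.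
  + move=> [s [s0 s1 pE]]; apply/F2; exists (s * l1).
    by rewrite smulA -pE addrC subrK mulr_ge0 ?(ltW l0)// gtr_pMl.
- split; apply/seteqP; split=> p.
  + move=> /F1r[s [s0 s1 ->]]; exists (s / l1).
    by rewrite -sE [a1 + _]addrC addrK divr_gt0// ler_pdivrMr// mul1r.
  + move=> [s [s0 s1 pE]]; apply/F1r; exists (s * l1).
    by rewrite smulA -pE addrC subrK mulr_gt0// ger_pMl.
  + move=> /F2r[s [s0 s1 ->]]; exists (s / l1).
    by rewrite -sE [a2 + _]addrC addrK divr_gt0// ler_pdivrMr// mul1r.
  + move=> [s [s0 s1 pE]]; apply/F2r; exists (s * l1).
    by rewrite smulA -pE addrC subrK mulr_gt0// ger_pMl.
Qed.

Lemma hits_singleton w l x : hits w [set l] x = ((w (x - l))%:R : R)%:E.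
Proof.
rewrite /hits -mass1; congr (mass w _); apply/seteqP; split=> y /=.
  by move=> <-; rewrite opprB addrC subrK.
by move=> ->; rewrite opprB addrC subrK.
Qed.

(** Both sides count the closed segment, split at one end or at the other. *)
Lemma hits_seg1_segr w e x : e != 0 ->
  (hits w (seg1 e) x + ((w (x - e))%:R)%:E = ((w x)%:R : R)%:E + hits w (segr e) x)%E.
Proof.
move=> e0; have eI (s : R) : smul s e = e -> s = 1.
  move=> E; have := congr1 (dot e) E; rewrite dotZr => /eqP.
  by rewrite -subr_eq0 -{2}[dot e e]mul1r -mulrBl mulf_eq0 (gt_eqF (dotnn_gt0 e0))
    orbF subr_eq0 => /eqP.
have eI0 (s : R) : smul s e = 0 -> s = 0.
  move=> E; have := congr1 (dot e) E; rewrite dotZr => /eqP.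
  have -> : dot e 0 = 0 by rewrite /dot /= !mulr0 addr0.
  by rewrite mulf_eq0 (gt_eqF (dotnn_gt0 e0)) orbF => /eqP.
have xE := hits_singleton w 0 x; rewrite subr0 in xE.
rewrite -hits_singleton -xE -!hits_disjoint.
- congr (hits w _ x); apply/seteqP; split=> p.
    move=> [[s [s0 s1 pE]]|/= ->].
      have [s00|s00] := eqVneq s 0; first by left; rewrite pE s00 /= smul0.
      by right; exists s; split => //; [rewrite lt_neqAle eq_sym s00|exact: ltW].
    by right; exists 1; split=> //; apply: pairP => /=; rewrite mul1r.
  move=> [/= ->|[s [s0 s1 pE]]]; first by left; exists 0; rewrite smul0.
  have [s11|s11] := eqVneq s 1.
    by right; rewrite /= pE s11; apply: pairP => /=; rewrite mul1r.
  by left; exists s; split=> //; [exact: ltW|rewrite lt_neqAle s11].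
- apply/seteqP; split => // p [/= -> [s [s0 _ /esym/eI0 sE]]].
  by move: s0; rewrite sE ltxx.
- apply/seteqP; split => // p [[s [_ s1 pE]] /= pe].
  by move: s1; rewrite (eI s) -?pE ?pe// ltxx.
Qed.

Lemma seg1_fin w e x : locally_bounded w -> hits w (seg1 e) x \is a fin_num.
Proof.
move=> wlb; apply: (@hits_fin _ _ wlb _ _ (`|e.1| + `|e.2|)) => p [s [s0 s1 ->]] /=.
rewrite !normrM (ger0_norm s0).
have aux (c d : R) : 0 <= c -> 0 <= d -> s * c <= c + d.
  by move=> c0 d0; have := ler_wpM2r c0 (ltW s1); lra.
by rewrite [X in _ /\ _ <= X]addrC; split; apply: aux.
Qed.

Lemma segr_fin w e x : locally_bounded w -> hits w (segr e) x \is a fin_num.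
Proof.
move=> wlb; apply: (@hits_fin _ _ wlb _ _ (`|e.1| + `|e.2|)) => p [s [s0 s1 ->]] /=.
rewrite !normrM (gtr0_norm s0).
have aux (c d : R) : 0 <= c -> 0 <= d -> s * c <= c + d.
  by move=> c0 d0; have := ler_wpM2r c0 s1; lra.
by rewrite [X in _ /\ _ <= X]addrC; split; apply: aux.
Qed.

(* The two half-open versions of the edge differ by its end points. *)
Lemma seg_difference w e t : locally_bounded w -> e != 0 ->
  (forall x, hits w (seg1 e) x = hits w (seg1 e) (x - t)) ->
  (forall x, hits w (segr e) x = hits w (segr e) (x - t)) ->
  forall y, (w (y + t + e))%:R - (w (y + t))%:R = (w (y + e))%:R - (w y)%:R :> R.
Proof.
move=> wlb e0 H1 Hr y.
have := hits_seg1_segr w (y + e) e0; have := hits_seg1_segr w (y + t + e) e0.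
rewrite H1 Hr !addrK; have -> : y + t + e - t = y + e by rewrite addrAC addrK.
rewrite -(fineK (seg1_fin _ _ wlb)) -(fineK (segr_fin _ _ wlb)) -!EFinD.
by move=> [a] [b]; move: a b; move: (fine _) (fine _) => X Y; lra.
Qed.

Lemma tiling_edge_hits hs w k (D : R) n e t : n != 0 -> locally_bounded w ->
  {ae mu2, forall x, hits w (halfplanes hs) x = (k%:R : R)%:E} ->
  (forall h, h \in hs -> h.1 != 0) ->
  (forall p, halfplanes hs p -> `|p.1| <= D /\ `|p.2| <= D) ->
  edge hs n e t ->
  (forall x, hits w (seg1 e) x = hits w (seg1 e) (x - t)) /\
  (forall x, hits w (segr e) x = hits w (segr e) (x - t)).
Proof.
move=> n0 wlb T hs0 hsD [a [c [_ _ [F1 F2] [F1r F2r]]]].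
have u0 := rot_neq0 n0.
have orth h : h \in hs -> dot h.1 (rot n) = 0 -> dot h.1 n != 0.
  move=> hhs hu; apply/negP => /eqP hn.
  have := @dot0_smul _ (rot n) n h.1 u0 n0 _ _; rewrite !(dotC (rot n)) (dotC n h.1) hn mul0r.
  by move=> /(_ (dot_rot n) hu) h0; have := hs0 _ hhs; rewrite h0 smul0 eqxx.
have orth' h : h \in hs -> dot h.1 (- rot n) = 0 -> dot h.1 n != 0.
  by move=> hhs; rewrite dotNr => /eqP; rewrite oppr_eq0 => /eqP; apply: orth.
split=> x.
  have := tiling_face wlb hsD (x + a) T orth.
  by rewrite F1 F2 !hits_shift opprD addrA addrK => ->.
have := tiling_face wlb hsD (x + a) T orth'.
by rewrite F1r F2r !hits_shift opprD addrA addrK => ->.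
Qed.
End Edge.

(** * Construction of the lattice *)

Section Lattice.
Variables (R : realType).
Implicit Types (w : R * R -> nat) (p q u e x l t z : R * R) (f : R * R -> R).

Definition cross p q : R := p.1 * q.2 - p.2 * q.1.

Definition in_lat p q z :=
  exists a b : int, z = smul a%:~R p + smul b%:~R q.

Lemma cross_coord p q z : cross p q != 0 ->
  z = smul (cross z q / cross p q) p + smul (cross p z / cross p q) q.
Proof. by rewrite /cross => c0; apply: pairP => /=; field. Qed.

Lemma periodic_nat f z n : periodic z f -> periodic (smul n%:R z) f.
Proof.
move=> pf; elim: n => [|n IH] x; first by rewrite smul0 addr0.
by rewrite -natr1 smulDl addrA (_ : smul 1 z = z) ?pf ?IH//; apply: pairP => /=; ring.
Qed.

Lemma periodic_int f z (k : int) : periodic z f -> periodic (smul k%:~R z) f.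
Proof.
move=> pf; case: k => n; first exact: periodic_nat.
move=> x; rewrite NegzE mulrNz smulN.
by have := periodic_nat n.+1 pf (x - smul n.+1%:R z); rewrite subrK => <-.
Qed.

(** No two displacements differ along [e], so the translated segments are pairwise disjoint and no
    point is counted twice. *)
Lemma hits_disjoint_sum w e (X : nat -> R * R) M x :
  (forall i j s, (i < j)%N -> X j - X i <> smul s e) ->
  (\sum_(m < M) hits w (seg1 e) (x + X m)%R)%E =
  mass w [set l | exists2 m, (m < M)%N & seg1 e (x + X m - l)].
Proof.
move=> dX; elim: M => [|M IH].
  by rewrite big_ord0 -(mass0 w); apply: mass_supp => l _; split=> // -[].
rewrite big_ord_recr /= IH /hits -mass_disjoint.
  congr (mass w _); apply/seteqP; split=> l /=.
    by move=> [[m mM H]|H]; [exists m => //; exact: leqW|exists M].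
  by move=> [m]; rewrite ltnS leq_eqVlt => /orP[/eqP ->|mM] H; [right|left; exists m].
apply/seteqP; split => // l [/= [m mM [s [_ _ E]]] [s' [_ _ E']]].
apply: (dX m M (s' - s) mM); rewrite smulDl smulN -E -E'.
by apply: pairP => /=; ring.
Qed.

(** The value [e = 0] is meaningful: it gives back [w], so that [commensurable] serves both for
    points and for lines. *)
Definition linedens w e x : R := fine (hits w (seg1 e) x).

Lemma linedens_ge0 w e x : 0 <= linedens w e x.
Proof. by rewrite fine_ge0// mass_ge0. Qed.

Lemma linedensE w e x : locally_bounded w -> hits w (seg1 e) x = (linedens w e x)%:E.
Proof. by move=> wlb; rewrite /linedens fineK// seg1_fin. Qed.

Lemma seg1_norm e p : seg1 e p -> `|p.1| <= `|e.1| /\ `|p.2| <= `|e.2|.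
Proof.
move=> [s [s0 s1 ->]] /=; rewrite !normrM (ger0_norm s0).
by split; apply: ler_piMl => //; apply: ltW.
Qed.

Lemma linedens_bdd w e : locally_bounded w -> bdd (linedens w e).
Proof.
move=> wlb; have [C HC] := wlb (`|e.1| + `|e.2|); exists C => x.
rewrite ger0_norm ?linedens_ge0// -lee_fin -linedensE//; apply: le_trans (HC x).
apply: mass_le => l _ /seg1_norm[h1 h2].
split; rewrite distrC; [apply: le_trans h1 _|apply: le_trans h2 _].
  by rewrite lerDl.
by rewrite lerDr.
Qed.

Lemma linedens0 w x : linedens w 0 x = (w x)%:R.
Proof.
rewrite /linedens (_ : seg1 0 = [set 0]); first by rewrite hits_singleton subr0.
have s0 (s : R) : smul s 0 = 0 by apply: pairP => /=; rewrite mulr0.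
apply/seteqP; split=> p; first by move=> [s [_ _ ->]]; rewrite s0.
by move=> ->; exists 0; rewrite s0.
Qed.

(* Pigeonhole: the multiples of [z], reduced modulo [p] and [q], lie in a
   bounded region, which meets only boundedly many lines of a given density. *)
Lemma commensurable w e p q z A y (al be : R) : locally_bounded w -> averaging A ->
  0 < A (linedens w e) y -> periodic p (A (linedens w e)) ->
  periodic q (A (linedens w e)) -> periodic z (A (linedens w e)) ->
  z = smul al p + smul be q ->
  exists N (a b : int) s, (0 < N)%N /\
    smul N%:R z = smul a%:~R p + smul b%:~R q + smul s e.
Proof.
move=> wlb aA fy pp pq pz zE; apply: contrapT => H.
pose fl (r : R) (m : nat) : int := Num.floor (m%:R * r).
(* The multiple [m z] reduced modulo [p] and [q]. Two of these differing along [e] would give the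
   conclusion with [N = j - i]. *)
pose X m := smul m%:R z - smul (fl al m)%:~R p - smul (fl be m)%:~R q.
have dX i j s : (i < j)%N -> X j - X i <> smul s e.
  move=> ij E; apply: H; exists (j - i)%N, (fl al j - fl al i), (fl be j - fl be i), s.
  rewrite subn_gt0 ij natrB 1?ltnW// !intrB -E; split=> //.
  by rewrite /X; apply: pairP => /=; ring.
have frac (r : R) m : `|m%:R * r - (fl r m)%:~R| <= 1.
  have /andP[h1 h2] := floor_itv (m%:R * r).
  rewrite ger0_norm ?subr_ge0// ltW// ltrBlDl.
  by move: h2; rewrite intrD.
have XE m : X m = smul (m%:R * al - (fl al m)%:~R) p + smul (m%:R * be - (fl be m)%:~R) q.
  by rewrite /X zE; apply: pairP => /=; ring.
pose D := `|p.1| + `|q.1| + `|e.1| + (`|p.2| + `|q.2| + `|e.2|).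
have [C HC] := wlb D.
have sumle M x : \sum_(m < M) linedens w e (x + X m) <= C.
  rewrite -lee_fin -sumEFin; under eq_bigr do rewrite -linedensE//.
  rewrite hits_disjoint_sum//; apply: le_trans (HC x).
  apply: mass_le => l _ [m _ /seg1_norm[h1 h2]].
  have aux (a b c d c' x1 l1 X1 : R) : `|c| <= 1 -> `|d| <= 1 -> X1 = c * a + d * b ->
      `|x1 + X1 - l1| <= `|c'| -> `|l1 - x1| <= `|a| + `|b| + `|c'|.
    move=> c1 d1 -> H1.
    have -> : l1 - x1 = c * a + d * b - (x1 + (c * a + d * b) - l1) by ring.
    apply: (le_trans (ler_normB _ _)); rewrite lerD//.
    by apply: (le_trans (ler_normD _ _)); rewrite !normrM lerD// ler_piMl.
  have b1 := aux p.1 q.1 _ _ e.1 x.1 l.1 _ (frac al m) (frac be m)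
    (congr1 fst (XE m)) h1.
  have b2 := aux p.2 q.2 _ _ e.2 x.2 l.2 _ (frac al m) (frac be m)
    (congr1 snd (XE m)) h2.
  split; [apply: (le_trans b1)|apply: (le_trans b2)]; rewrite /D.
    by rewrite lerDl !addr_ge0.
  by rewrite lerDr !addr_ge0.
pose f := A (linedens w e).
have fX m : f (y + X m) = f y.
  rewrite /f /X -!smulN -!mulrNz !addrA (periodic_int _ pq) (periodic_int _ pp).
  exact: periodic_nat.
have bl := linedens_bdd e wlb.
have bX v : bdd (fun x => linedens w e (x + v)) by apply: (@bdd_comp _ _ _ (+%R^~ v)).
(* The averages at the points [y + X m] all equal [f y]; averaging the bounded sum thus bounds [M]
   times [f y] for every [M], against [0 < f y]. *)
have fle M : M%:R * f y <= C.
  case: (aA) => _ Ale Ash Ac; rewrite -[leRHS](Ac C y).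
  apply: (@le_trans _ _ (A (fun x => \sum_(m < M) linedens w e (x + X m)) y)).
    rewrite (@averaging_sum _ _ A _ _ (fun (m : 'I_M) x => linedens w e (x + X m)))//.
    under eq_bigr => m _ do rewrite Ash// -/f fX.
    by rewrite sumr_const card_ord mulr_natl.
  apply: Ale => //; last exact: bdd_cst.
  exists C => x; rewrite ger0_norm//; apply: sumr_ge0 => m _; exact: linedens_ge0.
have := fle (Num.bound (`|C| / f y)).
rewrite leNgt => /negP; apply.
rewrite -ltr_pdivrMr//; apply: (@le_lt_trans _ _ (`|C| / f y)).
  by rewrite ler_pM2r ?invr_gt0// ler_norm.
by apply: archi_boundP; rewrite divr_ge0// ltW.
Qed.

Lemma common_multiple (I : eqType) (s : seq I) (Q : I -> nat -> Prop) :
  (forall i, i \in s -> exists2 N, (0 < N)%N & Q i N) ->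
  (forall i N M, Q i N -> Q i (M * N)%N) ->
  exists2 N, (0 < N)%N & forall i, i \in s -> Q i N.
Proof.
move=> + QM; elim: s => [_|i s IH H]; first by exists 1%N.
have [|N N0 HN] := IH; first by move=> j js; apply: H; rewrite in_cons js orbT.
have [M M0 HM] := H i (mem_head _ _).
exists (M * N)%N; first by rewrite muln_gt0 M0.
move=> j; rewrite in_cons => /orP[/eqP ->|/HN]; last exact: QM.
by rewrite mulnC; apply: QM.
Qed.

Lemma smul_int_mul M (a : int) p :
  smul M%:R (smul a%:~R p) = smul (M%:Z * a)%:~R p.
Proof. by rewrite intrM -smulA. Qed.

Lemma smulDr (r : R) p q : smul r (p + q) = smul r p + smul r q.
Proof. by apply: pairP => /=; ring. Qed.

Lemma in_lat_div p q z N : (0 < N)%N ->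
  (exists a b : int, smul N%:R z = smul a%:~R p + smul b%:~R q) ->
  in_lat (smul N%:R^-1 p) (smul N%:R^-1 q) z.
Proof.
move=> N0 [a [b E]]; exists a, b.
have NE : N%:R^-1 * N%:R = 1 :> R by rewrite mulVf// pnatr_eq0 -lt0n.
have -> : z = smul N%:R^-1 (smul N%:R z).
  by rewrite -smulA NE; apply: pairP => /=; rewrite mul1r.
by rewrite E smulDr -!smulA (mulrC a%:~R) (mulrC b%:~R).
Qed.

Lemma lattice_exists (I : eqType) (s : seq I) (e t : I -> R * R) w :
  locally_bounded w -> (exists x, (0 < w x)%N) ->
  (forall i, i \in s -> e i != 0) ->
  (forall i, i \in s -> cross (e i) (t i) != 0) ->
  (forall i j, i \in s -> j \in s -> i != j -> cross (e i) (e j) != 0) ->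
  (forall i, i \in s -> forall x, hits w (seg1 (e i)) x = hits w (seg1 (e i)) (x - t i)) ->
  (forall i, i \in s -> forall x, hits w (segr (e i)) x = hits w (segr (e i)) (x - t i)) ->
  exists p q, cross p q != 0 /\ forall i, i \in s -> in_lat p q (t i) \/
    in_lat p q (e i) /\ exists r, in_lat p q (t i + smul r (e i)).
Proof.
move=> wlb [x0 wx0] e0 et0 ee H1 Hr.
pose W x : R := (w x)%:R.
have W0E : linedens w 0 = W by apply/funext => x; rewrite linedens0.
have bW : bdd W by rewrite -W0E; apply: linedens_bdd.
have [||A [aA [y Ay] HA]] := @periodic_averages R _ I s e t W x0 bW.
- by rewrite pnatr_eq0 -lt0n.
- by move=> i si; apply: seg_difference; auto.
have Age0 f g : bdd f -> bdd g -> (forall x, f x <= g x) -> forall x, A f x <= A g x.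
  by case: aA => _ Ale _ _; exact: Ale.
have {}Ay : 0 < A W y.
  rewrite lt_neqAle eq_sym Ay /=; case: (aA) => _ _ _ Ac; rewrite -[leLHS](Ac 0 y).
  by apply: Age0 => //; exact: bdd_cst.
pose per v := forall g, bdd g -> periodic v (A g).
pose v i := if `[< per (e i) >] then e i else t i.
have vper i : i \in s -> per (v i).
  by rewrite /v => /HA; case: asboolP => // ? [].
have vE i : v i = e i /\ per (e i) \/ v i = t i.
  by rewrite /v; case: asboolP => ?; [left|right].
have t0 i : i \in s -> t i != 0.
  by move=> /et0; apply: contra => /eqP ->; rewrite /cross /= !mulr0 subrr.
have v0 i : i \in s -> v i != 0.
  by move=> si; case: (vE i) => [[->] _|->]; [apply: e0|apply: t0].
have com p q z al be : per p -> per q -> per z -> z = smul al p + smul be q ->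
    exists2 N, (0 < N)%N & exists a b : int, smul N%:R z = smul a%:~R p + smul b%:~R q.
  move=> pp pq pz zE; have [||||N [a [b [r [N0 E]]]]] :=
    @commensurable w 0 p q z A y al be wlb aA _ _ _ _ zE; rewrite ?W0E;
    [done|exact: pp|exact: pq|exact: pz|].
  exists N => //; exists a, b; rewrite E (_ : smul r 0 = 0) ?addr0//.
  by apply: pairP => /=; rewrite mulr0.
(* Two independent chosen vectors span the required lattice up to division by a common [N].
   Otherwise all chosen vectors lie on one line and a second generator must be found elsewhere. *)
have [[i [j [si sj vij]]]|par] := pselect (exists i j, [/\ i \in s, j \in s & cross (v i) (v j) != 0]).
  pose p := v i; pose q := v j.
  have comv k : k \in s -> exists2 N, (0 < N)%N &
      exists a b : int, smul N%:R (v k) = smul a%:~R p + smul b%:~R q.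
    by move=> sk; apply: com (cross_coord (v k) vij); apply: vper.
  (* Only the density along [e k] is known to have [t k] as a period, so commensurability is
     obtained up to a multiple of [e k]. *)
  have comt k : k \in s -> v k = e k -> per (e k) -> exists2 N, (0 < N)%N &
      exists a b : int, exists r, smul N%:R (t k) = smul a%:~R p + smul b%:~R q + smul r (e k).
    move=> sk vk pe; have bl := linedens_bdd (e k) wlb.
    have [||||N [a [b [r [N0 E]]]]] :=
      @commensurable w (e k) p q (t k) A y _ _ wlb aA _ _ _ _ (cross_coord (t k) vij).
    (* The half-open segment contains its starting point, so the density dominates [W] and its
       average at [y] is positive as well. *)
    - apply: (lt_le_trans Ay); apply: Age0 => // x.
      rewrite -lee_fin -linedensE// -[(W x)%:E]mass1; apply: mass_le => _ _ ->.
      by exists 0; rewrite subrr smul0.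
    - exact: vper.
    - exact: vper.
    - apply: averaging_periodic => // x; rewrite /linedens H1// addrK //.
    - by exists N => //; exists a, b, r.
  have scale k N M : (exists a b : int, smul N%:R (v k) = smul a%:~R p + smul b%:~R q) ->
      exists a b : int, smul (M * N)%:R (v k) = smul a%:~R p + smul b%:~R q.
    move=> [a [b E]]; exists (M%:Z * a), (M%:Z * b).
    by rewrite natrM smulA E smulDr !smul_int_mul.
  have scale' k N M : (exists a b : int, exists r, smul N%:R (t k) =
        smul a%:~R p + smul b%:~R q + smul r (e k)) ->
      exists a b : int, exists r, smul (M * N)%:R (t k) =
        smul a%:~R p + smul b%:~R q + smul r (e k).
    move=> [a [b [r E]]]; exists (M%:Z * a), (M%:Z * b), (M%:R * r).
    by rewrite natrM smulA E !smulDr !smul_int_mul -smulA.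
  have [||N N0 HN] := @common_multiple I s (fun k N =>
      (exists a b : int, smul N%:R (v k) = smul a%:~R p + smul b%:~R q) /\
      (v k = e k -> per (e k) -> exists a b : int, exists r, smul N%:R (t k) =
        smul a%:~R p + smul b%:~R q + smul r (e k))).
  - move=> k sk; have [N1 N10 E1] := comv k sk.
    have [[vk pe]|nvk] := pselect (v k = e k /\ per (e k)).
      have [N2 N20 E2] := comt k sk vk pe.
      exists (N2 * N1)%N; first by rewrite muln_gt0 N20.
      by split; [exact: scale|move=> _ _; rewrite mulnC; exact: scale'].
    by exists N1 => //; split=> // vk pe; case: nvk.
  - by move=> k N M [h1 h2]; split; [exact: scale|move=> vk pe; apply: scale'; exact: h2].
  have Ni : N%:R != 0 :> R by rewrite pnatr_eq0 -lt0n.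
  exists (smul N%:R^-1 p), (smul N%:R^-1 q); split.
    rewrite /cross /= (_ : _ - _ = N%:R^-1 * N%:R^-1 * cross p q); last by rewrite /cross; ring.
    by rewrite !mulf_neq0// invr_neq0.
  move=> k sk; have [Hv Ht] := HN k sk; have Lv := in_lat_div N0 Hv.
  case: (vE k) => [[vk pe]|vk]; last by left; rewrite -vk.
  right; split; first by rewrite -vk.
  have [a [b [r E]]] := Ht vk pe; exists (- (N%:R^-1 * r)).
  apply: in_lat_div => //; exists a, b; rewrite smulDr E -smulA.
  by rewrite mulrN mulrA divff// mul1r smulN addrK.
have {}par i j : i \in s -> j \in s -> cross (v i) (v j) = 0.
  move=> si sj; apply/eqP; apply: contrapT => /negP c0; apply: par.
  by exists i, j.
case: s => [|i0 s'] in H1 Hr ee et0 e0 HA vper t0 v0 par *.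
  by exists (1, 0), (0, 1); split=> //; rewrite /cross /= mulr1 mul0r subr0 oner_neq0.
set s := i0 :: s' in H1 Hr ee et0 e0 HA vper t0 v0 par *.
have si0 : i0 \in s by rewrite mem_head.
pose d := v i0; have d0 := v0 _ si0.
have [N N0 HN] : exists2 N, (0 < N)%N & forall i, i \in s ->
    exists a : int, smul N%:R (v i) = smul a%:~R d.
  apply: common_multiple => [i si|i N M [a E]]; last first.
    by exists (M%:Z * a); rewrite natrM smulA E smul_int_mul.
  have vd : v i = smul (dot d (v i) / dot d d) d + smul 0 0.
    rewrite smul0 addr0; apply: parallel_smul => //.
    by apply/eqP; rewrite -subr_eq0 -/(cross d (v i)) par.
  have [|N N0 [a [b E]]] := com _ _ _ _ _ (vper _ si0) _ (vper _ si) vd.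
    by move=> g _ x; rewrite addr0.
  exists N => //; exists a; rewrite E (_ : smul _ 0 = 0) ?addr0//.
  by apply: pairP => /=; rewrite mulr0.
have Ni : N%:R^-1 != 0 :> R by rewrite invr_neq0// pnatr_eq0 -lt0n.
pose p := smul N%:R^-1 d.
have p0 : p != 0.
  apply: contra d0 => /eqP p0; have dE : d = smul N%:R p.
    rewrite -smulA divff ?pnatr_eq0 -?lt0n//.
    by apply: pairP => /=; rewrite mul1r.
  by rewrite -/d dE p0; apply/eqP; apply: pairP => /=; rewrite mulr0.
have pv q i : i \in s -> in_lat p q (v i).
  move=> /HN[a E].
  have -> : q = smul N%:R^-1 (smul N%:R q).
    by rewrite -smulA mulVf ?pnatr_eq0 -?lt0n//; apply: pairP => /=; rewrite mul1r.
  by apply: in_lat_div => //; exists a, 0; rewrite E mulr0z smul0 addr0.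
(* If [k] has chosen [e k], no other edge has chosen its own vector, since edge vectors are pairwise
   non-parallel. The others lie in the multiples of [p] through their [t i], and [t k], transversal
   to [e k], is free to be the second generator. *)
have [[k [sk vk pe]]|nk] := pselect (exists k, [/\ k \in s, v k = e k & per (e k)]).
  exists p, (t k); split.
    have dk : d = smul (dot (v k) d / dot (v k) (v k)) (v k).
      apply: parallel_smul; first exact: v0.
      by apply/eqP; rewrite -subr_eq0 -/(cross (v k) d) par.
    have := p0.
    rewrite /p dk vk -smulA; set c := _ * _ => c0.
    have -> : cross (smul c (e k)) (t k) = c * cross (e k) (t k) by rewrite /cross /=; ring.
    rewrite mulf_neq0 ?et0//; apply: contra c0 => /eqP ->.
    by rewrite smul0.
  move=> i si; left; have [->|ik] := eqVneq i k.
    exists 0, 1; rewrite mulr0z smul0 add0r; apply: pairP => /=; by rewrite mul1r.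
  case: (vE i) => [[vi pei]|vi]; last by rewrite -vi; exact: pv.
  by have := ee _ _ si sk ik; rewrite -vi -vk par// eqxx.
(* Every chosen vector is a [t i] on the line of [p], so any transversal second generator will
   do. *)
exists p, (rot p); split.
  have -> : cross p (rot p) = dot p p by rewrite /cross /dot /=; ring.
  by rewrite gt_eqF// dotnn_gt0.
move=> i si; left; case: (vE i) => [[vi pe]|vi]; last by rewrite -vi; exact: pv.
by case: nk; exists i.
Qed.
End Lattice.

(** * Lattice tilings *)

Section Null.
Variables (R : realType).
Implicit Types (n x : R * R).
Local Notation mu2 := (@lebesgue_measure R \x @lebesgue_measure R)%E.

Lemma locally_constant (f : R -> R) :
  (forall t, exists2 e, 0 < e & forall d, `|d| < e -> f (t + d) = f t) ->
  forall s t, f s = f t.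
Proof.
move=> H s t; apply: is_derive_0_is_cst => r.
apply: (@near_eq_is_derive _ _ _ (cst (f r))).
have [e e0 He] := H r; exists e => //= y; rewrite /= distrC => /He.
by rewrite addrC subrK.
Qed.

(** A vertical line is a product with a one-point factor; any other line has one-point vertical
    sections. *)
Lemma line_null n (c : R) : n != 0 -> mu2 [set x | dot n x = c] = 0%E.
Proof.
move=> n0; have [n2|n2] := eqVneq n.2 0.
  have n1 : n.1 != 0 by apply: contra n0 => /eqP n1; apply/eqP; apply: pairP.
  have -> : [set x | dot n x = c] = [set c / n.1] `*` setT.
    apply/seteqP; split=> x; rewrite /dot /= n2 mul0r addr0.
      by move=> <-; split=> //=; rewrite mulrC mulKf.
    by move=> [/= -> _]; rewrite mulrC divfK.
  rewrite product_measure1E; [|exact: measurable_set1|exact: measurableT].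
  rewrite -[(_ * _)%E]/(lebesgue_measure [set (c / n.1)%R] * lebesgue_measure [set: R])%E.
  by rewrite lebesgue_measure_set1 mul0e.
rewrite /product_measure1 /=; apply: integral0_eq => x _ /=.
suff -> : xsection [set x | dot n x = c] x = [set (c - n.1 * x) / n.2].
  exact: lebesgue_measure_set1.
apply/seteqP; split=> y; rewrite /xsection /= inE /dot /=.
  by move=> <-; rewrite addrC addKr mulrC mulKf.
by move=> ->; rewrite [n.2 * _]mulrC divfK// addrC subrK.
Qed.

Lemma line_measurable n (c : R) : measurable [set x : R * R | dot n x = c].
Proof.
have mf : measurable_fun [set: R * R] (dot n).
  apply: measurable_funD; apply: measurable_funM; try exact: measurable_cst.
    exact: measurable_fst.
  exact: measurable_snd.
have := mf measurableT [set c] (measurable_set1 c).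
by rewrite setTI.
Qed.

Lemma line_negligible n (c : R) : n != 0 -> mu2.-negligible [set x | dot n x = c].
Proof.
move=> n0; exists [set x | dot n x = c]; split => //; first exact: line_measurable.
exact: line_null.
Qed.
End Null.

(** * Balanced faces make the count constant *)

Section Const.
Variables (R : realType) (w : R * R -> nat) (hs : seq (R * R * R)) (D : R).
Implicit Types (n u v x z : R * R).
Hypothesis wlb : locally_bounded w.
Hypothesis hsD : forall p, halfplanes hs p -> `|p.1| <= D /\ `|p.2| <= D.

Definition transversal u z := forall h, h \in hs -> dot h.1 u = 0 -> dot h.1 z != 0.

Hypothesis balanced : forall u z, u != 0 -> transversal u z ->
  forall x, hits w (face hs z u) x = hits w (face hs (- z) u) x.

Lemma weak_generic v : generic hs v -> weak hs v = half hs v.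
Proof.
move=> gv; apply/seteqP; split=> p H h hhs; have [|[h1 h2]] := H h hhs; try by left.
  by right; split => //; rewrite lt_neqAle h2 gv.
by right; split => //; exact: ltW.
Qed.

Lemma face_generic z v x : generic hs v -> hits w (face hs z v) x = 0%E.
Proof.
move=> gv; rewrite -(mass0 w); apply: mass_supp => l _; split=> // -[_ [h [hhs hv _ _]]].
by have := gv h hhs; rewrite hv eqxx.
Qed.

(** As the direction moves from [v0] to [v1], the count can change only when it becomes parallel to
    a side, and there one face is traded for the opposite one. The direction 0 must be avoided, as
    it is parallel to all sides. *)
Lemma hits_segment v0 v1 x : generic hs v0 -> generic hs v1 ->
  (forall t, v0 + smul t (v1 - v0) != 0) ->
  hits w (half hs v0) x = hits w (half hs v1) x.
Proof.
move=> g0 g1 nz; pose z := v1 - v0; pose v t := v0 + smul t z.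
(* At a generic [t] this is the count of [half hs (v t)]. Elsewhere it is the count just to the
   right of [t], and by balance also the one just to the left, so [G] is locally constant. *)
pose G t := fine (hits w (weak hs (v t)) x) - fine (hits w (face hs z (v t)) x).
have Ggen t : generic hs (v t) -> G t = fine (hits w (half hs (v t)) x).
  by move=> gt; rewrite /G weak_generic// face_generic//= subr0.
have trans t : transversal (v t) z.
  move=> h hhs hv; apply/negP => /eqP hz; have := g0 h hhs.
  by move: hv; rewrite dotDr dotZr hz mulr0 addr0 => ->; rewrite eqxx.
have half_eq t z' d : hits w (weak hs (v t)) x =
    (hits w (half hs (v t + smul d z')%R) x + hits w (face hs z' (v t)) x)%E ->
    fine (hits w (half hs (v t + smul d z')) x) =
    fine (hits w (weak hs (v t)) x) - fine (hits w (face hs z' (v t)) x).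
  move=> ->; rewrite fineD; first by rewrite addrK.
    exact: (half_fin wlb hsD).
  exact: (face_fin wlb hsD).
have Glc t : exists2 e, 0 < e & forall d, `|d| < e -> G (t + d) = G t.
  have [e1 e10 H1] := hits_turn w x (trans t).
  have trN : transversal (v t) (- z).
    by move=> h hhs hv; rewrite dotNr oppr_eq0; apply: trans hv.
  have [e2 e20 H2] := hits_turn w x trN.
  exists (Num.min e1 e2); first by rewrite lt_min e10.
  move=> d; rewrite lt_min => /andP[d1 d2].
  have [d0|d0|->] := ltgtP d 0; last by rewrite addr0.
  - have vE : v (t + d) = v t + smul (- d) (- z).
      by rewrite /v; apply: pairP => /=; ring.
    rewrite (ltr0_norm d0) in d1 d2.
    have [|gd Ed] := H2 (- d) _ (ltW d2); first by rewrite oppr_gt0.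
    rewrite Ggen vE// (half_eq _ _ _ Ed) -balanced//; exact: nz.
  - have vE : v (t + d) = v t + smul d z by rewrite /v smulDl addrA.
    rewrite (gtr0_norm d0) in d1 d2.
    have [gd Ed] := H1 d d0 (ltW d1).
    by rewrite Ggen vE// (half_eq _ _ _ Ed).
have := locally_constant Glc 0 1.
have v0E : v 0 = v0 by rewrite /v smul0 addr0.
have v1E : v 1 = v1 by rewrite /v /z; apply: pairP => /=; ring.
rewrite !Ggen ?v0E ?v1E// => E.
by rewrite -(fineK (half_fin wlb hsD v0 x)) E fineK// (half_fin wlb hsD).
Qed.

Lemma segment_neq0 v0 v1 : cross v0 v1 != 0 -> forall t, v0 + smul t (v1 - v0) != 0.
Proof.
move=> c0 t; apply: contra c0 => /eqP E.
have E1 : v0.1 + t * (v1.1 - v0.1) = 0 by have := congr1 fst E.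
have E2 : v0.2 + t * (v1.2 - v0.2) = 0 by have := congr1 snd E.
have tc : t * cross v0 v1 = 0.
  have -> : t * cross v0 v1 = v0.1 * (v0.2 + t * (v1.2 - v0.2)) -
    v0.2 * (v0.1 + t * (v1.1 - v0.1)) by rewrite /cross; ring.
  by rewrite E1 E2 !mulr0 subrr.
have tc' : (1 - t) * cross v0 v1 = 0.
  have -> : (1 - t) * cross v0 v1 = v1.2 * (v0.1 + t * (v1.1 - v0.1)) -
    v1.1 * (v0.2 + t * (v1.2 - v0.2)) by rewrite /cross; ring.
  by rewrite E1 E2 !mulr0 subrr.
by rewrite -[cross _ _]mul1r -(subrK t 1) mulrDl tc tc' addr0.
Qed.

Lemma generic_transversal v : (forall h, h \in hs -> h.1 != 0) -> v != 0 ->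
  generic hs v -> exists v', generic hs v' /\ cross v v' != 0.
Proof.
move=> hs0 v0 gv; have [|e e0 He] := @half_turn _ hs v (rot v).
  by move=> h hhs hv; have := gv h hhs; rewrite hv eqxx.
have [ge _] := He e e0 (lexx _); exists (v + smul e (rot v)); split=> //.
have -> : cross v (v + smul e (rot v)) = e * dot v v by rewrite /cross /dot /=; ring.
by rewrite mulf_neq0 ?gt_eqF ?dotnn_gt0.
Qed.

Lemma generic_exists : (forall h, h \in hs -> h.1 != 0) -> exists2 v, v != 0 & generic hs v.
Proof.
move=> hs0; pose u : R * R := (1, 0).
have u0 : u != 0 by apply/eqP => -[] /eqP; rewrite oner_eq0.
have [|e e0 He] := @half_turn _ hs u (rot u).
  move=> h hhs hu; apply/negP => /eqP hr; have := hs0 h hhs; apply/negP; rewrite negbK.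
  move: hu hr; rewrite /dot /= oppr0 !mulr0 !mulr1 addr0 add0r => h1 h2.
  by apply/eqP; apply: pairP; rewrite ?h1 ?h2.
have [ge _] := He e e0 (lexx _); exists (u + smul e (rot u)) => //.
apply/eqP => E; have := congr1 fst E; rewrite /= oppr0 mulr0 addr0 => /eqP.
by rewrite oner_eq0.
Qed.

(** Parallel directions may be opposite, in which case the segment between them meets 0; a detour
    through a third direction avoids this. *)
Lemma hits_generic v0 v1 x : (forall h, h \in hs -> h.1 != 0) ->
  v0 != 0 -> v1 != 0 -> generic hs v0 -> generic hs v1 ->
  hits w (half hs v0) x = hits w (half hs v1) x.
Proof.
move=> hs0 v00 v10 g0 g1.
have [c|c] := eqVneq (cross v0 v1) 0; last by apply: hits_segment => //; apply: segment_neq0.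
have [v2 [g2 c2]] := generic_transversal hs0 v00 g0.
rewrite (hits_segment x g0 g2 (segment_neq0 c2)); apply: hits_segment => //.
apply: segment_neq0.
have v1E : v1 = smul (dot v0 v1 / dot v0 v0) v0.
  by apply: parallel_smul => //; apply/eqP; rewrite -subr_eq0 -/(cross v0 v1) c.
set r := _ / _ in v1E; have r0 : r != 0.
  by apply: contra v10 => /eqP r0; rewrite v1E r0 smul0.
have -> : cross v2 v1 = - r * cross v0 v2 by rewrite v1E /cross /=; ring.
by rewrite mulf_neq0// oppr_eq0.
Qed.

Lemma hits_constant v x y : (forall h, h \in hs -> h.1 != 0) -> v != 0 ->
  generic hs v -> hits w (half hs v) x = hits w (half hs v) y.
Proof.
move=> hs0 v0 gv; have [v' [gv' c]] := generic_transversal hs0 v0 gv.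
(* Independence of the direction allows [half hs u] for steps forward along [u] and [half hs (- u)]
   for steps backward. *)
have line u z (r : R) : u != 0 -> generic hs u ->
    hits w (half hs v) (z + smul r u) = hits w (half hs v) z.
  move=> u0 gu; rewrite !(hits_generic _ hs0 v0 u0 gv gu).
  have gNu : generic hs (- u) by move=> h hhs; rewrite dotNr oppr_eq0 gu.
  have Nu0 : - u != 0 by rewrite oppr_eq0.
  pose G t := fine (hits w (half hs u) (z + smul t u)).
  have /locally_constant/(_ r 0) : forall t, exists2 e, 0 < e &
      forall d, `|d| < e -> G (t + d) = G t.
    move=> t; have [e1 e10 H1] := hits_half_step wlb hsD (z + smul t u) gu.
    have [e2 e20 H2] := hits_half_step wlb hsD (z + smul t u) gNu.
    exists (Num.min e1 e2); first by rewrite lt_min e10.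
    move=> d; rewrite lt_min => /andP[d1 d2]; rewrite /G; congr fine.
    have [d0|d0|->] := ltgtP d 0; last by rewrite addr0.
      rewrite (ltr0_norm d0) in d1 d2.
      rewrite !(hits_generic _ hs0 u0 Nu0 gu gNu) -[RHS](H2 (- d)) ?oppr_gt0//.
      by congr (hits w _ _); apply: pairP => /=; ring.
    rewrite (gtr0_norm d0) in d1 d2.
    by rewrite -[RHS](H1 d)// smulDl addrA.
  rewrite /G smul0 addr0 => E.
  by rewrite -(fineK (half_fin wlb hsD u _)) E fineK// (half_fin wlb hsD).
have v'0 : v' != 0.
  by apply: contra c => /eqP ->; rewrite /cross /= !mulr0 subrr.
rewrite -(subrK y x) addrC (cross_coord (x - y) c) addrA.
by rewrite !line.
Qed.
End Const.

Definition lat_map (R : realType) (p q : R * R) (k : int * int) : R * R :=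
  smul k.1%:~R p + smul k.2%:~R q.

Lemma lat_map_is_zmod_morphism (R : realType) (p q : R * R) :
  zmod_morphism (lat_map p q).
Proof. by move=> k l; apply: pairP; rewrite /lat_map /= !intrB; ring. Qed.

HB.instance Definition _ (R : realType) (p q : R * R) :=
  GRing.isZmodMorphism.Build _ _ (lat_map p q) (lat_map_is_zmod_morphism p q).

(** * Lattices as multi-sets, and their periods *)

Section Period.
Variables (R : realType).
Implicit Types (w : R * R -> nat) (A : set (R * R)) (p q u n e x l t z : R * R)
  (hs : seq (R * R * R)).

Lemma cross_comb p q (a b : R) : cross (smul a p + smul b q) q = a * cross p q /\
  cross p (smul a p + smul b q) = b * cross p q.
Proof. by rewrite /cross /=; split; ring. Qed.

(** By Cramer's rule each integer coefficient of [z] times [cross p q] is a cross product of [z]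
    with a generator. For small [z] this is below [cross p q] in absolute value, so the coefficients
    vanish. *)
Lemma in_lat_small p q : cross p q != 0 -> exists2 r, 0 < r &
  forall z, in_lat p q z -> `|z.1| <= r -> `|z.2| <= r -> z = 0.
Proof.
move=> c0; pose S := `|p.1| + `|p.2| + (`|q.1| + `|q.2|) + 1.
have cc : 0 < `|cross p q| by rewrite normr_gt0.
have p1 := normr_ge0 p.1; have p2 := normr_ge0 p.2.
have q1 := normr_ge0 q.1; have q2 := normr_ge0 q.2.
have S0 : 0 < S by rewrite /S; lra.
exists (`|cross p q| / (2 * S)); first by rewrite divr_gt0// mulr_gt0.
set r := _ / _; have rS : r * (2 * S) = `|cross p q|.
  by rewrite divfK// gt_eqF// mulr_gt0.
have r0 : 0 < r by rewrite divr_gt0// mulr_gt0.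
move=> z [a [b zE]] z1 z2; have [ca cb] := cross_comb p q a%:~R b%:~R.
rewrite -zE in ca cb.
have bound (v : R * R) (k : int) : `|v.1| + `|v.2| <= S ->
    `|k%:~R * cross p q| = `|z.1 * v.2 - z.2 * v.1| -> k = 0.
  move=> vS kE; apply/eqP; rewrite -normr_le0 -ltzD1 add0r -(ltr_int R) intr_norm.
  have : `|z.1 * v.2 - z.2 * v.1| <= r * (`|v.1| + `|v.2|).
    apply: (le_trans (ler_normB _ _)); rewrite !normrM mulrDr addrC.
    by apply: lerD; apply: ler_wpM2r.
  rewrite -kE normrM => H; rewrite -(ltr_pM2r cc) mul1r.
  have : r * (`|v.1| + `|v.2|) <= r * S by rewrite ler_pM2l.
  have : 0 < r * S by rewrite mulr_gt0.
  by move: rS H; rewrite mulrCA; lra.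
have a0 : a = 0.
  by apply: (bound q); [rewrite /S; lra|rewrite -ca /cross].
have b0 : b = 0.
  apply: (bound p); first by rewrite /S; lra.
  by rewrite -cb /cross -normrN; congr (`|_|); ring.
by rewrite zE a0 b0 !mulr0z !smul0 addr0.
Qed.

Lemma in_latB p q x y : in_lat p q x -> in_lat p q y -> in_lat p q (x - y).
Proof.
move=> [a [b ->]] [a' [b' ->]]; exists (a - a'), (b - b').
by apply: pairP => /=; rewrite !intrB; ring.
Qed.

Lemma in_lat0 p q : in_lat p q 0.
Proof. by exists 0, 0; rewrite !mulr0z !smul0 addr0. Qed.

Lemma in_latD p q x y : in_lat p q x -> in_lat p q y -> in_lat p q (x + y).
Proof.
by move=> Lx Ly; rewrite -[y]opprK -[- y]sub0r; apply: in_latB => //; apply: in_latB Ly;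
  exact: in_lat0.
Qed.

Lemma in_lat_lattice p q : cross p q != 0 -> lattice [set z | in_lat p q z].
Proof.
move=> c0; have [r r0 Hr] := in_lat_small c0; split.
- split; first by rewrite inE; exact: in_lat0.
  by move=> x y; rewrite !inE; exact: in_latB.
- move=> x Lx; split; first by rewrite inE.
  exists (ball x r); first exact: nbhsx_ballx.
  apply/seteqP; split=> [y [[y1 y2] Ly]|y ->]; last first.
    by split=> //; apply: ballxx.
  apply/eqP; rewrite -subr_eq0 -oppr_eq0 opprB; apply/eqP; apply: Hr.
  + exact: in_latB.
  + by move: y1; rewrite /ball /= => /ltW.
  + by move: y2; rewrite /ball /= => /ltW.
- exists (lat_map p q); split.
  + by move=> [a b] _; exists a, b.
  + move=> [a b] [a' b'] _ _ abE.
    have E : smul a%:~R p + smul b%:~R q = smul a'%:~R p + smul b'%:~R q := abE.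
    have [h1 h2] := cross_comb p q a%:~R b%:~R.
    have [h3 h4] := cross_comb p q a'%:~R b'%:~R.
    rewrite E in h1 h2; move: h1 h2; rewrite h3 h4.
    by move=> /(mulIf c0)/intr_inj -> /(mulIf c0)/intr_inj ->.
  + by move=> z [a [b ->]]; exists (a, b).
Qed.

Definition latw p q : R * R -> nat := multiset_of_set [set z | in_lat p q z].

Lemma latwE p q l : (0 < latw p q l)%N <-> in_lat p q l.
Proof.
rewrite /latw /multiset_of_set; split; first by rewrite lt0b inE.
by move=> L; rewrite lt0b inE.
Qed.

Lemma latw_locally_bounded p q : cross p q != 0 -> locally_bounded (latw p q).
Proof.
move=> c0; have [r r0 Hr] := in_lat_small c0.
apply: (@small_boxes_locally_bounded _ _ (r / 2) 1) => [|y]; first lra.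
have [[l [[l1 l2] Ll]]|ne] := pselect (exists l, box y (r / 2) l /\ in_lat p q l); last first.
  rewrite (_ : mass _ _ = 0%E) ?lee_fin ?ler01// -(mass0 (latw p q)).
  by apply: mass_supp => l /latwE Ll; split=> // yl; case: ne; exists l.
apply: (@le_trans _ _ (mass (latw p q) [set l])).
  apply: mass_le => l' /latwE Ll' [l'1 l'2]; apply/eqP; rewrite -subr_eq0; apply/eqP.
  have aux (a b c : R) : `|a - c| <= r / 2 -> `|b - c| <= r / 2 -> `|a - b| <= r.
    by rewrite !ler_norml => /andP[? ?] /andP[? ?]; apply/andP; split; lra.
  by apply: Hr; [exact: in_latB|apply: aux l'1 l1|apply: aux l'2 l2].
by rewrite mass1 lee_fin (_ : 1 = 1%:R)// ler_nat /latw /multiset_of_set; case: (_ \in _).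
Qed.

Definition period w t := forall l, w (l + t) = w l.

Lemma periodN w t : period w t -> period w (- t).
Proof. by move=> wt l; have := wt (l - t); rewrite subrK => ->. Qed.

Lemma latw_period p q t : in_lat p q t -> period (latw p q) t.
Proof.
move=> Lt l; rewrite /latw /multiset_of_set; congr nat_of_bool.
apply/idP/idP; rewrite !inE => H; last exact: in_latD.
by rewrite -(addrK t l); apply: in_latB.
Qed.

Lemma hits_period w A x t : period w t -> hits w A (x - t) = hits w A x.
Proof.
move=> wt; rewrite /hits /mass (reindex_esum [set l | A (x - l)] _ (fun l => l - t)).
  by apply: eq_esum => l _; rewrite (periodN wt).
split.
- by move=> l Al /=; rewrite opprB addrA subrK.
- by move=> l l' _ _ /addIr.
- by move=> l Al; exists (l + t); rewrite ?addrK//= opprD addrA addrAC.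
Qed.

Lemma period_int w e (k : int) : period w e -> period w (smul k%:~R e).
Proof.
move=> we; have nat_per (n : nat) : period w (smul n%:R e).
  elim: n => [|n IH] l; first by rewrite smul0 addr0.
  by rewrite -natr1 smulDl addrA (_ : smul 1 e = e) ?we ?IH//; apply: pairP => /=; ring.
case: k => n; first exact: nat_per.
by move=> l; rewrite NegzE mulrNz smulN; apply: periodN (nat_per n.+1) l.
Qed.

(** When a half-open segment slides along itself, what is lost at one end is regained at the other,
    one period [e] away. *)
Lemma hits_seg1_slide w e x (r : R) : e != 0 -> period w e ->
  hits w (seg1 e) (x - smul r e) = hits w (seg1 e) x.
Proof.
move=> e0 we; pose k := Num.floor r; pose s := r - k%:~R.
have /andP[s0 s1] : 0 <= s < 1.
  have /andP[h1 h2] := floor_itv r; rewrite /s subr_ge0 h1 /= ltrBlDl.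
  by rewrite intrD in h2.
have -> : smul r e = smul s e + smul k%:~R e by rewrite -smulDl /s subrK.
rewrite opprD addrA hits_period; last exact: period_int.
have eI (a b : R) : smul a e = smul b e -> a = b.
  move=> E; have := congr1 (dot e) E; rewrite !dotZr => /mulIf; apply.
  by rewrite gt_eqF// dotnn_gt0.
pose I (a b : R) : set (R * R) := [set z | exists v, [/\ a <= v, v < b & z = smul v e]].
have cut (a b c : R) y : a <= b -> b <= c ->
    hits w (I a c) y = (hits w (I a b) y + hits w (I b c) y)%E.
  move=> ab bc; rewrite -hits_disjoint.
    congr (hits w _ y); apply/seteqP; split=> z.
      by move=> [v [v1 v2 ->]]; have [h|h] := ltP v b; [left|right]; exists v.
    move=> [[v [v1 v2 ->]]|[v [v1 v2 ->]]]; exists v; split=> //.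
      exact: lt_le_trans bc.
    exact: le_trans v1.
  apply/seteqP; split=> // z [[v [v1 v2 ->]] [v' [v1' _ /eI E]]].
  by move: v2; rewrite E ltNge v1'.
have shift (a b c : R) y : hits w (I a b) (y - smul c e) = hits w (I (a + c) (b + c)) y.
  rewrite -hits_shift; congr (hits w _ y); apply/seteqP; split=> z /=.
    move=> [v [v1 v2 E]]; exists (v + c); rewrite lerD2r ltrD2r; split=> //.
    by rewrite smulDl -E subrK.
  move=> [v [v1 v2 ->]]; exists (v - c); rewrite lerBrDr ltrBlDr; split=> //.
  by rewrite -smulN -smulDl.
have seg1E : seg1 e = I 0 1 by [].
rewrite seg1E shift add0r (cut s 1)//; [|exact: ltW|by rewrite lerDl].
rewrite [RHS](cut 0 s)//; last exact: ltW.
rewrite addeC; congr (_ + _)%E.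
rewrite -[in RHS](hits_period _ x we) (_ : e = smul 1 e); last by apply: pairP => /=; ring.
by rewrite shift add0r (addrC s).
Qed.

(** This reduces the segments open at 0 to those closed at 0 and spares a second sliding
    argument. *)
Lemma segr_flip e : segr e = [set z | seg1 (- e) (z - e)].
Proof.
have eq (s : R) : smul (1 - s) (- e) = smul s e - e by apply: pairP => /=; ring.
apply/seteqP; split=> z /=.
  move=> [s [s0 s1 ->]]; exists (1 - s); rewrite eq; split=> //; lra.
move=> [s [s0 s1 E]]; exists (1 - s); split; [clear E; lra|clear E; lra|].
by rewrite -(subrK e z) E; apply: pairP => /=; ring.
Qed.

(** In the second case [t] is a period followed by a slide along [e], and neither changes the
    count. *)
Lemma hits_edge_balanced w e t : e != 0 ->
  period w t \/ period w e /\ (exists r, period w (t + smul r e)) ->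
  (forall x, hits w (seg1 e) (x - t) = hits w (seg1 e) x) /\
  (forall x, hits w (segr e) (x - t) = hits w (segr e) x).
Proof.
move=> e0 [wt|[we [r wr]]]; first by split=> x; apply: hits_period.
have tE : t = smul (- r) e + (t + smul r e) by rewrite smulN addrCA addNr addr0.
split=> x; rewrite {1}tE opprD addrA.
  by rewrite hits_period// hits_seg1_slide.
rewrite hits_period// segr_flip !hits_shift addrAC.
have -> : smul (- r) e = smul r (- e) by apply: pairP => /=; ring.
by rewrite hits_seg1_slide ?oppr_eq0//; apply: periodN.
Qed.

Lemma edge_balanced hs w n e t : e != 0 -> edge hs n e t ->
  period w t \/ period w e /\ (exists r, period w (t + smul r e)) ->
  forall x, hits w (face hs n (rot n)) x = hits w (face hs (- n) (rot n)) x /\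
    hits w (face hs n (- rot n)) x = hits w (face hs (- n) (- rot n)) x.
Proof.
move=> e0 [a [c [_ _ [-> ->] [-> ->]]]] /(hits_edge_balanced e0)[H1 H2] x.
by rewrite !hits_shift !opprD !addrA H1 H2.
Qed.

Lemma face_side hs n u z : n != 0 -> u != 0 -> dot n u = 0 -> 0 < dot n z ->
  face hs z u = face hs n u.
Proof.
move=> n0 u0 nu nz; congr (_ `&` _).
have nn := dotnn_gt0 n0.
have mE (h : R * R * R) : dot h.1 u = 0 -> (0 < dot h.1 z) = (0 < dot h.1 n).
  move=> hu; have -> : h.1 = smul (dot n h.1 / dot n n) n.
    by apply: (@dot0_smul _ u) => //; rewrite dotC.
  by rewrite !dotZl (pmulr_lgt0 _ nz) (pmulr_lgt0 _ nn).
by apply/seteqP; split=> x [h [hhs hu hz hx]]; exists h; split=> //;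
  [rewrite -mE|rewrite mE].
Qed.

(* Only the line of [u] and the side of [z] matter, so it is enough to
   consider the four faces attached to a normal [n]. *)
Lemma balanced_normal hs w n u z : n != 0 -> u != 0 -> dot n u = 0 -> dot n z != 0 ->
  (forall x, hits w (face hs n (rot n)) x = hits w (face hs (- n) (rot n)) x /\
    hits w (face hs n (- rot n)) x = hits w (face hs (- n) (- rot n)) x) ->
  forall x, hits w (face hs z u) x = hits w (face hs (- z) u) x.
Proof.
move=> n0 u0 nu nz H x.
have [z1 E] : exists z1, (z1 = n \/ z1 = - n) /\
    face hs z u = face hs z1 u /\ face hs (- z) u = face hs (- z1) u.
  have nn0 : - n != 0 by rewrite oppr_eq0.
  have nnu : dot (- n) u = 0 by rewrite dotNl nu oppr0.
  have [nz0|nz0|nz0] := ltgtP (dot n z) 0; last by rewrite nz0 eqxx in nz.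
  - exists (- n); rewrite opprK; split; first by right.
    by split; apply: face_side; rewrite // ?dotNl ?dotNr ?oppr_gt0.
  - exists n; split; first by left.
    by split; apply: face_side; rewrite // ?dotNl ?dotNr ?opprK.
case: E => z1n [-> ->].
have uE := dot0_rot n0 nu; set c := _ / _ in uE.
have c0 : c != 0 by apply: contra u0 => /eqP c0; rewrite uE c0 smul0.
have one (v : R * R) : smul 1 v = v by apply: pairP => /=; rewrite mul1r.
have [u1 [u1n E]] : exists u1, (u1 = rot n \/ u1 = - rot n) /\
    forall v, face hs v u = face hs v u1.
  have [cl|cl] := ltP c 0.
    exists (- rot n); split; first by right.
    move=> v; have -> : u = smul (- c) (- rot n) by rewrite uE; apply: pairP => /=; ring.
    by rewrite -{1}(one v) face_scale// oppr_gt0.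
  exists (rot n); split; first by left.
  by move=> v; rewrite uE -{1}(one v) face_scale// lt_neqAle eq_sym c0.
rewrite !E; have [h1 h2] := H x.
by case: z1n u1n => -> [] ->; rewrite ?opprK ?h1 ?h2.
Qed.

Lemma mass_nat w A (C : R) : (mass w A <= C%:E)%E ->
  exists k : nat, mass w A = (k%:R : R)%:E.
Proof.
move=> /mass_finite[s Hs]; pose s' := undup [seq l <- s | l \in A].
exists (\sum_(l <- s') w l)%N; rewrite (@mass_supp _ _ _ [set` s']).
  rewrite /mass esum_fset//=.
  by rewrite -fsbig_seq ?undup_uniq// natr_sum -sumEFin.
move=> l wl; rewrite /= mem_undup mem_filter /=.
by split=> [Al|/andP[/set_mem]]//; rewrite mem_set//= Hs.
Qed.
End Period.

(** * Assembly of the lattice tiling *)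

Section Final.
Variables (R : realType).
Implicit Types (w : R * R -> nat) (A : set (R * R)) (p q u n e x l t v z : R * R)
  (hs : seq (R * R * R)).
Local Notation mu2 := (@lebesgue_measure R \x @lebesgue_measure R)%E.

(** One representative for each direction of sides: opposite sides and repeated constraints share
    it, and the edge vectors become pairwise non-parallel, as [lattice_exists] requires. *)
Lemma nonparallel_normals hs : exists s : seq (R * R * R),
  [/\ forall k, k \in s -> k \in hs,
      forall h, h \in hs -> exists2 k, k \in s & cross h.1 k.1 = 0 &
      forall i j, i \in s -> j \in s -> i != j -> cross i.1 j.1 != 0].
Proof.
elim: hs => [|h hs [s [s1 s2 s3]]]; first by exists [::].
have [[k ks hk]|ne] := pselect (exists2 k, k \in s & cross h.1 k.1 = 0).
  exists s; split => //; first by move=> i /s1; rewrite in_cons orbC => ->.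
  by move=> i; rewrite in_cons => /orP[/eqP ->|/s2 //]; exists k.
have crossC p q : cross p q = - cross q p by rewrite /cross; ring.
exists (h :: s); split.
- by move=> k; rewrite !in_cons => /orP[->//|/s1 ->]; rewrite orbT.
- move=> i; rewrite in_cons => /orP[/eqP ->|/s2[k ks ik]]; last first.
    by exists k => //; rewrite in_cons ks orbT.
  by exists h; rewrite ?mem_head// /cross mulrC subrr.
- have nh k : k \in s -> cross h.1 k.1 != 0.
    by move=> ks; apply/eqP => hk; apply: ne; exists k.
  move=> i j; rewrite !in_cons => /orP[/eqP ->|iS] /orP[/eqP ->|js].
  + by rewrite eqxx.
  + by move=> _; exact: nh.
  + by move=> _; rewrite crossC oppr_eq0 nh.
  + exact: s3.
Qed.

(** The two sets differ only on side lines, and the translates of these by the lattice form a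
    countable family of null sets. *)
Lemma ae_half_halfplanes hs p q v : (forall h, h \in hs -> h.1 != 0) ->
  {ae mu2, forall x, hits (latw p q) (halfplanes hs) x = hits (latw p q) (half hs v) x}.
Proof.
(* [k] encodes the two lattice coefficients and the index of a side; codes of nothing and indices
   out of range give the empty set. *)
move=> hs0; pose N (k : nat) : set (R * R) :=
  if (choice.unpickle k : option ((int * int) * nat)) is Some (a, j) then
    if (j < size hs)%N then
      let h := nth (0, 0) hs j in [set x | dot h.1 x = h.2 + dot h.1 (lat_map p q a)]
    else set0
  else set0.
have : mu2.-negligible (\bigcup_k N k).
  apply: negligible_bigcup => k; rewrite /N.
  case: choice.unpickle => [[a j]|]; last exact: negligible_set0.
  case: ltnP => js; last exact: negligible_set0.
  by apply: line_negligible; apply: hs0; apply: mem_nth.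
apply: negligibleS => x /= nx; apply: contrapT => out; apply: nx.
apply: mass_supp => l /latwE[a [b lE]]; split; last exact: half_halfplanes.
move=> H h hhs; left; rewrite lt_neqAle H// andbT; apply/eqP => E; apply: out.
have [K KE] : exists K, choice.unpickle K = Some ((a, b), index h hs).
  by exists (choice.pickle ((a, b), index h hs)); exact: choice.pickleK.
exists K => //; rewrite /N KE index_mem hhs nth_index//= -E.
have -> : lat_map p q (a, b) = l by rewrite lE.
by rewrite -dotDr subrK.
Qed.

Lemma lattice_tiles hs (D : R) p q q0 : cross p q != 0 ->
  (forall h, h \in hs -> h.1 != 0) ->
  (forall x, halfplanes hs x -> `|x.1| <= D /\ `|x.2| <= D) ->
  (forall h, h \in hs -> dot h.1 q0 < h.2) ->
  (forall u z, u != 0 -> transversal hs u z ->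
    forall x, hits (latw p q) (face hs z u) x = hits (latw p q) (face hs (- z) u) x) ->
  multi_tiles (halfplanes hs) (latw p q).
Proof.
move=> c0 hs0 hsD Hq0 bal; have wlb := latw_locally_bounded c0.
have [v v0 gv] := generic_exists hs0.
have [C HC] : exists C : R, (hits (latw p q) (half hs v) q0 <= C%:E)%E.
  exists (fine (hits (latw p q) (half hs v) q0)).
  by rewrite fineK// (half_fin wlb hsD).
have [k kE] := mass_nat HC.
exists k.
  (* The multiplicity is positive because the translate by the lattice point 0 contains the interior
     point [q0]. *)
  rewrite -(ltr_nat R) -lte_fin -kE; apply: (@lt_le_trans _ _ (mass (latw p q) [set 0])).
    by rewrite mass1 lte_fin ltr0n; apply/latwE; exact: in_lat0.
  apply: mass_le => _ _ -> h hhs; left; rewrite subr0; exact: Hq0.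
apply/multi_tiles_hits.
have [M [mM M0 HM]] := ae_half_halfplanes p q v hs0.
exists M; split => // x /= nx; apply: HM => /= E; apply: nx.
by rewrite E -kE; apply: (hits_constant wlb hsD bal).
Qed.

Lemma tiling_lattice hs (D : R) q0 k w : locally_bounded w -> (0 < k)%N ->
  {ae mu2, forall x, hits w (halfplanes hs) x = (k%:R : R)%:E} ->
  (forall h, h \in hs -> h.1 != 0) ->
  (forall h, h \in hs -> dot h.1 q0 < h.2) ->
  (forall x, halfplanes hs x -> `|x.1| <= D /\ `|x.2| <= D) ->
  exists p q, cross p q != 0 /\ multi_tiles (halfplanes hs) (latw p q).
Proof.
move=> wlb k0 T hs0 Hq0 hsD.
have [s [shs rep npar]] := nonparallel_normals hs.
pose has_edge (h : R * R * R) := exists e t, edge hs h.1 e t.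
have dich h : h \in hs -> no_edge hs h.1 \/ has_edge h.
  by move=> hhs; apply: (tiling_edge (hs0 _ hhs) wlb k0 T hs0 Hq0 hsD).
have [F HF] : exists F : R * R * R -> (R * R) * (R * R),
    forall h, has_edge h -> edge hs h.1 (F h).1 (F h).2.
  have [h|F HF] := @boolp.choice _ _ (fun (h : R * R * R) (et : (R * R) * (R * R)) =>
    has_edge h -> edge hs h.1 et.1 et.2); last by exists F.
  have [[e [t et]]|ne] := pselect (has_edge h); first by exists (e, t).
  by exists (0, 0).
(* Directions without an edge have empty faces, which balance by themselves, so only the others
   constrain the lattice. Outside [has_edge] the function [F] has a default value. *)
pose s' := [seq h <- s | `[< has_edge h >]].
have s'P h : h \in s' -> [/\ h \in s, h \in hs, h.1 != 0 & edge hs h.1 (F h).1 (F h).2].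
  rewrite mem_filter => /andP[/asboolP he hS]; have hhs := shs _ hS.
  by split => //; [exact: hs0|exact: HF].
have e0 h : h \in s' -> (F h).1 != 0.
  move=> /s'P[_ _ n0 [a [c [[c0 ->] _ _ _]]]].
  apply: contra (rot_neq0 n0) => /eqP E; apply/eqP.
  have -> : rot h.1 = smul c^-1 (smul c (rot h.1)).
    by rewrite -smulA mulVf ?gt_eqF//; apply: pairP => /=; rewrite mul1r.
  by rewrite E; apply: pairP => /=; rewrite mulr0.
have [||||||p [q [c0 HL]]] :=
  @lattice_exists R _ s' (fun h => (F h).1) (fun h => (F h).2) w wlb.
- have [x [_ _ xk]] := ae_box 0 ltr01 T.
  have [|l wl _] := @hits_pos _ w (halfplanes hs) x; last by exists l.
  by rewrite xk lte_fin ltr0n.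
- exact: e0.
- move=> h /s'P[_ _ n0 [a [c [[c0 ->] nt _ _]]]].
  have -> : cross (smul c (rot h.1)) (F h).2 = - (c * dot h.1 (F h).2).
    by rewrite /cross /dot /=; ring.
  by rewrite oppr_eq0 mulf_neq0// gt_eqF.
- move=> i j /s'P[si _ _ [a [c [[c0 ->] _ _ _]]]] /s'P[sj _ _ [a' [c' [[c0' ->] _ _ _]]]] ij.
  have -> : cross (smul c (rot i.1)) (smul c' (rot j.1)) = c * c' * cross i.1 j.1.
    by rewrite /cross /=; ring.
  apply: mulf_neq0; last exact: npar.
  by apply: mulf_neq0; rewrite gt_eqF.
- by move=> h /s'P[_ _ n0 ed]; have [] := tiling_edge_hits n0 wlb T hs0 hsD ed.
- by move=> h /s'P[_ _ n0 ed]; have [] := tiling_edge_hits n0 wlb T hs0 hsD ed.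
exists p, q; split => //; apply: (lattice_tiles c0 hs0 hsD Hq0) => u z u0 uz x.
(* If no side is parallel to [u], both faces are empty; otherwise [u] is handled by the
   representative [r] of the normals orthogonal to it. *)
have [[h [hhs hu]]|none] := pselect (exists h, h \in hs /\ dot h.1 u = 0); last first.
  apply: mass_supp => l _.
  by split=> -[_ [h [hhs hu _ _]]]; case: none; exists h.
have [r rs hr] := rep _ hhs.
have r0 := hs0 _ (shs _ rs); have h0 := hs0 _ hhs.
have hE : h.1 = smul (dot r.1 h.1 / dot r.1 r.1) r.1.
  by apply: parallel_smul => //; apply/eqP; rewrite eq_sym -subr_eq0; apply/eqP;
    rewrite -hr /cross; ring.
set c := _ / _ in hE.
have cn0 : c != 0 by apply: contra h0 => /eqP c00; rewrite hE c00 smul0.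
have ru : dot r.1 u = 0.
  by move: hu; rewrite hE dotZl => /eqP; rewrite mulf_eq0 (negbTE cn0) => /eqP.
have rz : dot r.1 z != 0.
  by have := uz _ hhs hu; rewrite hE dotZl mulf_eq0 (negbTE cn0).
apply: (balanced_normal r0 u0 ru rz) => {}x.
have [[-> -> -> ->]|he] := dich _ (shs _ rs); first by [].
have rs' : r \in s' by rewrite mem_filter rs andbT; apply/asboolP.
apply: (edge_balanced (e0 _ rs') (HF _ he)).
have [Lt|[Le [b Lb]]] := HL _ rs'; [left|right]; first exact: latw_period.
by split; [exact: latw_period|exists b; exact: latw_period].
Qed.

End Final.

Theorem corollary1p7 (R : realType) (P : set (R * R)) :
  convex_polygon P ->
  (exists2 m : R * R -> nat, discrete_multiset m & multi_tiles P m) ->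
  exists2 L : set (R * R), lattice L & multi_tiles P (multiset_of_set L).
Proof.
move=> /convex_polygon_halfplanes[hs [D [q0 [r [-> hs0 hsD r0 Hq]]]]].
move=> [w _ [k k0 /multi_tiles_hits T]].
have wlb := tiling_locally_bounded r0 Hq T.
have [p [q [c0 H]]] := tiling_lattice wlb k0 T hs0 (halfplanes_strict r0 hs0 Hq) hsD.
by exists [set z | in_lat p q z]; [exact: in_lat_lattice|exact: H].
Qed.
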